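(* As formal power series in $q$ (equivalently, as analytic functions for $0<|q|<1$), \[ \sum_{n=0}^{\infty}\big(N(0,4;n)-N(2,4;n)\big)q^{n} = 2-2q^2g(-q^2;q^{16}) +2q^5g(-q^6;q^{16}) -\frac{J_{2,4}\overline{J}_{6,16}}{J_4}+q\,\frac{J_{2,4}\overline{J}_{2,16}}{J_4}. \]
   Context: Throughout, $q$ is a complex number with $0<|q|<1$. Write $(x)_n=(x;q)_n=\prod_{i=0}^{n-1}(1-q^ix)$ and $(x)_\infty=(x;q)_\infty=\prod_{i\ge0}(1-q^ix)$. Let $j(x;q)=(x)_\infty(q/x)_\infty(q)_\infty=\sum_{n\in\mathbb Z}(-1)^nq^{\binom n2}x^n$. For integers $a$ and $m\ge1$: $J_{a,m}=j(q^a;q^m)$, $\overline{J}_{a,m}=j(-q^a;q^m)$, and $J_m=J_{m,3m}=\prod_{i\ge1}(1-q^{mi})$. The universal mock theta function is $g(x;q)=x^{-1}\big(-1+\sum_{n\ge0}\frac{q^{n^2}}{(x)_{n+1}(q/x)_n}\big)$. Ranks: define integers $N(m,n)$ ($m\in\mathbb Z$, $n\ge0$) by $\sum_{n\ge0}\sum_{m\in\mathbb Z}N(m,n)z^mq^n=\sum_{n\ge0}\frac{q^{n^2}}{(zq)_n(z^{-1}q)_n}$; for $n\ge1$, $N(m,n)$ is the number of partitions of $n$ with rank (largest part minus number of parts) equal to $m$, and $N(m,0)=\delta_{m,0}$. For $M\ge1$ and an integer $a$, $N(a,M;n)=\sum_{m\equiv a \pmod M}N(m,n)$. *)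

(* Defs.v *)
From HB Require Import structures.
From mathcomp Require Import all_boot all_order all_algebra.
Set Implicit Arguments. Unset Strict Implicit. Unset Printing Implicit Defensive.
Import Order.TTheory GRing.Theory Num.Theory.
Local Open Scope ring_scope.

Definition fps := nat -> int.

Definition fps_const (c : int) : fps := fun n => if n == 0%N then c else 0.
Definition fps_X (e : nat) : fps := fun n => if n == e then 1 else 0.
Definition fps_add (f g : fps) : fps := fun n => f n + g n.
Definition fps_opp (f : fps) : fps := fun n => - f n.
Definition fps_sub (f g : fps) : fps := fps_add f (fps_opp g).
Definition fps_scale (c : int) (f : fps) : fps := fun n => c * f n.
Definition fps_mul (f g : fps) : fps :=
  fun n => \sum_(i < n.+1) f i * g (n - i)%N.
Definition fps_prod (s : seq fps) : fps := foldr fps_mul (fps_const 1) s.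

(* Multiplicative inverse of a series whose constant term is a unit of int
   (i.e. f 0 = 1 or f 0 = -1, so that (f 0)^-1 = f 0):
   b_0 = f_0,  b_n = - f_0 * sum_{i=1}^n f_i b_{n-i}. *)
Fixpoint fps_inv_seq (f : fps) (n : nat) : seq int :=
  match n with
  | 0 => [:: f 0%N]
  | n'.+1 => let s := fps_inv_seq f n' in
             rcons s (- f 0%N * \sum_(i < n'.+1) f i.+1 * nth 0 s (n' - i)%N)
  end.
Definition fps_inv (f : fps) : fps := fun n => nth 0 (fps_inv_seq f n) n.
Definition fps_div (f g : fps) : fps := fps_mul f (fps_inv g).

(* Infinite sum of a family F n whose n-th member has order >= n:
   the coefficient of q^k only receives contributions from n <= k. *)
Definition fps_sum_inf (F : nat -> fps) : fps :=
  fun k => \sum_(n < k.+1) F n k.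

Definition qpoch (c : int) (a m n : nat) : fps :=
  fps_prod [seq fps_sub (fps_const 1) (fps_scale c (fps_X (a + m * i)))
           | i <- iota 0 n].
(* (c q^a; q^m)_oo ; for m >= 1 the factors with index i > k do not affect
   the coefficient of q^k, so that coefficient equals that of the
   finite product over i < k+1. *)
Definition qpoch_inf (c : int) (a m : nat) : fps :=
  fun k => qpoch c a m k.+1 k.

(* j(x; q^m) = (x;q^m)_oo (q^m/x;q^m)_oo (q^m;q^m)_oo for x = c q^a,
   c in {1,-1} (so 1/c = c) and a <= m. *)
Definition jfun (c : int) (a m : nat) : fps :=
  fps_mul (qpoch_inf c a m) (fps_mul (qpoch_inf c (m - a) m) (qpoch_inf 1 m m)).

Definition Jam (a m : nat) : fps := jfun 1 a m.
Definition Jbar (a m : nat) : fps := jfun (-1) a m.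
Definition Jm (m : nat) : fps := Jam m (3 * m).

(* A pair (k, f) represents q^(-k) * f. *)
Definition lser := (nat * fps)%type.
Definition lser_of (f : fps) : lser := (0%N, f).
Definition lconst (c : int) : lser := lser_of (fps_const c).
Definition lqpow (e : nat) : lser := lser_of (fps_X e).
Definition ladd (F G : lser) : lser :=
  ((F.1 + G.1)%N, fps_add (fps_mul (fps_X G.1) F.2) (fps_mul (fps_X F.1) G.2)).
Definition lopp (F : lser) : lser := (F.1, fps_opp F.2).
Definition lsub (F G : lser) : lser := ladd F (lopp G).
Definition lmul (F G : lser) : lser := ((F.1 + G.1)%N, fps_mul F.2 G.2).
(* equality of Laurent series: q^(-k) f = q^(-l) g  iff  q^l f = q^k g *)
Definition lser_eq (F G : lser) : Prop :=
  forall n : nat, fps_mul (fps_X G.1) F.2 n = fps_mul (fps_X F.1) G.2 n.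

(* g(x; q^m) for x = c q^b with c in {1,-1} (so x^{-1} = c q^{-b}),
   1 <= b < m:
   g(x;q^m) = x^{-1} ( -1 + sum_{n>=0} q^{m n^2} / ((x;q^m)_{n+1} (q^m/x;q^m)_n) ). *)
Definition gsum (c : int) (b m : nat) : fps :=
  fps_sum_inf (fun n =>
    fps_div (fps_X (m * n ^ 2))
            (fps_mul (qpoch c b m n.+1) (qpoch c (m - b) m n))).
Definition gmock (c : int) (b m : nat) : lser :=
  lmul ((b, fps_const c) : lser) (lser_of (fps_add (fps_const (-1)) (gsum c b m))).

(* A partition of n is encoded by its multiplicity function
   f : 'I_n -> 'I_n.+1, where f i is the number of parts equal to i+1;
   the partition condition is sum_i (i+1) * f i = n.  (Bijective with
   partitions of n; for n = 0 there is exactly the empty partition.) *)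
Definition ptype (n : nat) := {ffun 'I_n -> 'I_n.+1}.
Definition is_partition (n : nat) (f : ptype n) : bool :=
  (\sum_(i < n) i.+1 * f i)%N == n.
Definition largest_part (n : nat) (f : ptype n) : nat :=
  (\max_(i < n | (f i : nat) != 0%N) i.+1)%N.
Definition num_parts (n : nat) (f : ptype n) : nat := (\sum_(i < n) (f i : nat))%N.
(* rank = largest part - number of parts (the empty partition has rank 0) *)
Definition prank (n : nat) (f : ptype n) : int :=
  (largest_part f)%:Z - (num_parts f)%:Z.

Definition Nrank (a : int) (M n : nat) : nat :=
  #|[set f : ptype n | is_partition f && ((prank f - a) %% M%:Z == 0)%Z]|.

(* Main.v *)
(* At z = i the rank generating function is (1 - i)(1 + i g(i;q)), an integral series.  Put
     H(x) = 1 + x g(x;q) + q x g(-q x^2;q^4) - q x^(-2) g(-q^3 x^2;q^4).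
   The functional equation g(qx) = -x^3 g(x) - x^2 - x, which is a telescoping sum, gives
   H(qx) = -q x^3 H(x), so that H(x) j(x;q) j(-q x^2;q^2) is invariant under x -> qx and free of
   poles, hence constant; its value at x = 1 is (q;q)^2 j(-q;q^2).  The case x = i expresses the
   rank series by g(q;q^4), and the case x = q, with q replaced by q^4, expresses g(q;q^4) by
   g(-q^2;q^16) and g(-q^6;q^16).  The remaining theta quotients are matched by the dissection of
   j(x;q) into j(-q x^2;q^4) - x j(-q^3 x^2;q^4), also obtained from the shift x -> qx.
   Formally, infinite products and sums are truncated and all identities hold modulo powers
   of q. *)
Require Import Defs.
From HB Require Import structures.
From mathcomp Require Import all_boot all_order all_algebra all_field.
From mathcomp Require Import boolp ring zify.
Set Implicit Arguments. Unset Strict Implicit. Unset Printing Implicit Defensive.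
Import Order.TTheory GRing.Theory Num.Theory.
Local Open Scope ring_scope.

(** * Formal power series *)

(** H is dictated by its shift. Under x -> qx the two terms over base q^4 trade places with
    multiplier -q x^3, up to the inhomogeneous part q x^2 - 1; x g(x) contributes -q x^3 - q x^2,
    and together these turn the constant 1 into -q x^3. The points x = i and (over base q^4) x = q
    are chosen because both produce g(q;q^4), which can then be eliminated; the symmetry g(x;q) =
    g(q/x;q) merges the remaining arguments. The obstacle is that x is not a complex variable here.
    A function of x is truncated, multiplied by the power x^D that clears its denominators, and read
    as a polynomial over a ring in which q is regular. The shift then holds only modulo q^L, but it
    still forces every coefficient except that of x^D to be negligible. This coefficient does not
    depend on the point, so values at two points can be compared. Evaluation at u needs u to divide
    q, so that powers of q absorb the negative powers of u; 1, i and q inside base q^4 all qualify.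
    Only x = i leaves the integers, and real parts lead back. *)

(* [pser int] is convertible with [fps], and its ring operations with those of [Defs]. *)
Definition pser (R : Type) := nat -> R.
HB.instance Definition _ (R : Type) := gen_eqMixin (pser R).
HB.instance Definition _ (R : Type) := gen_choiceMixin (pser R).

Section SeriesRing.
Variable R : comNzRingType.
Implicit Types f g h : pser R.

Definition ps_zero : pser R := fun=> 0.
Definition ps_add f g : pser R := fun n => f n + g n.
Definition ps_opp f : pser R := fun n => - f n.
Definition ps_mul f g : pser R := fun n => \sum_(i < n.+1) f i * g (n - i)%N.
Definition pconst (c : R) : pser R := fun n => if n == 0%N then c else 0.
Definition ptrunc N f : {poly R} := \poly_(i < N) f i.

Fact ps_addA : associative ps_add.
Proof. by move=> f g h; apply/funext => n; rewrite /ps_add addrA. Qed.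
Fact ps_addC : commutative ps_add.
Proof. by move=> f g; apply/funext => n; rewrite /ps_add addrC. Qed.
Fact ps_add0 : left_id ps_zero ps_add.
Proof. by move=> f; apply/funext => n; rewrite /ps_add add0r. Qed.
Fact ps_addN : left_inverse ps_zero ps_opp ps_add.
Proof. by move=> f; apply/funext => n; rewrite /ps_add addNr. Qed.

HB.instance Definition _ :=
  GRing.isZmodule.Build (pser R) ps_addA ps_addC ps_add0 ps_addN.

(** The ring laws of the Cauchy product are inherited from [{poly R}] through this truncation. *)
Lemma ps_mulE N f g n : (n < N)%N -> ps_mul f g n = (ptrunc N f * ptrunc N g)`_n.
Proof.
move=> ltnN; rewrite coefM; apply: eq_bigr => i _; rewrite !coef_poly.
by rewrite !ifT //; [exact: leq_ltn_trans (leq_subr _ _) _ |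
                     exact: leq_ltn_trans (leq_ord i) _].
Qed.

Fact ps_mulC : commutative ps_mul.
Proof. by move=> f g; apply/funext => n; rewrite !(@ps_mulE n.+1) // mulrC. Qed.

Fact ps_mulA : associative ps_mul.
Proof.
move=> f g h; apply/funext => n.
transitivity ((ptrunc n.+1 f * (ptrunc n.+1 g * ptrunc n.+1 h))`_n).
  rewrite coefM; apply: eq_bigr => i _; rewrite coef_poly ltn_ord.
  by rewrite (@ps_mulE n.+1) // ltnS leq_subr.
rewrite mulrA coefM; apply: eq_bigr => i _.
by rewrite (@ps_mulE n.+1 f g i) // coef_poly ltnS leq_subr.
Qed.

Fact ps_mul1 : left_id (pconst 1) ps_mul.
Proof.
move=> f; apply/funext => n; rewrite /ps_mul big_ord_recl /= mul1r subn0.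
by rewrite big1 ?addr0 // => i _; rewrite /pconst /= mul0r.
Qed.

Fact ps_mulDl : left_distributive ps_mul ps_add.
Proof.
move=> f g h; apply/funext => n; rewrite /ps_mul /ps_add -big_split /=.
by apply: eq_bigr => i _; rewrite mulrDl.
Qed.

Fact ps_1neq0 : pconst 1 != 0 :> pser R.
Proof. by apply/eqP => /(congr1 (fun f : pser R => f 0%N)) /eqP; rewrite oner_eq0. Qed.

HB.instance Definition _ := GRing.Zmodule_isComNzRing.Build (pser R)
  ps_mulA ps_mulC ps_mul1 ps_mulDl ps_1neq0.

Lemma psM f g n : (f * g) n = \sum_(i < n.+1) f i * g (n - i)%N.
Proof. by []. Qed.
Lemma psD f g n : (f + g) n = f n + g n. Proof. by []. Qed.
Lemma psN f n : (- f) n = - f n. Proof. by []. Qed.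
Lemma ps0 n : (0 : pser R) n = 0. Proof. by []. Qed.
Lemma ps1 n : (1 : pser R) n = (n == 0%N)%:R. Proof. by case: n. Qed.
Lemma ps_sum I (r : seq I) (P : pred I) (F : I -> pser R) n :
  (\sum_(i <- r | P i) F i) n = \sum_(i <- r | P i) F i n.
Proof. by elim/big_rec2: _ => //= i x y _ <-. Qed.

Lemma psM0 f g : (f * g) 0%N = f 0%N * g 0%N.
Proof. by rewrite psM big_ord1. Qed.

Definition qX : pser R := fun n => if n == 1%N then 1 else 0.

Lemma qXM f n : (qX * f) n = if n is n'.+1 then f n' else 0.
Proof.
rewrite psM; case: n => [|n]; first by rewrite big_ord1 mul0r.
rewrite 2!big_ord_recl /= mul0r add0r mul1r subSS subn0 big1 ?addr0 // => i _.
by rewrite /qX /= mul0r.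
Qed.

Lemma qXnM e f n : (qX ^+ e * f) n = if (n < e)%N then 0 else f (n - e)%N.
Proof.
elim: e f n => [|e IH] f n; first by rewrite mul1r subn0.
by rewrite exprS -mulrA qXM; case: n => [|n] //; rewrite IH ltnS subSS.
Qed.

Lemma qXn e n : (qX ^+ e) n = (n == e)%:R.
Proof. 
rewrite -[qX ^+ e]mulr1 qXnM ps1; case: ltngtP => //; rewrite ?subn_eq0.
  by move=> lt; rewrite leqNgt lt.
by move=> ->; rewrite leqnn.
Qed.

Lemma qXn_lreg e : GRing.lreg (qX ^+ e).
Proof.
move=> f g eqfg; apply/funext => n.
have /(congr1 (fun h : pser R => h (e + n)%N)) := eqfg.
by rewrite !qXnM ltnNge leq_addr /= addKn.
Qed.

(** Congruence modulo q^N. It takes the place of convergence: limits of products and sums are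
    reached by [eqm_eq]. *)
Definition eqm N f g := forall k, (k < N)%N -> f k = g k.

Lemma eqmP N f g : eqm N f g <-> exists c, f - g = qX ^+ N * c.
Proof.
split=> [eqfg|[c] /eqP]; last first.
  rewrite subr_eq => /eqP -> k ltkN; by rewrite psD qXnM ltkN add0r.
exists (fun n => (f - g) (n + N)%N); apply/funext => n.
rewrite qXnM; case: ltnP => [/eqfg|leNn]; last by rewrite subnK.
by rewrite psD psN => ->; rewrite subrr.
Qed.

Lemma eqm_refl N f : eqm N f f. Proof. by []. Qed.
Lemma eqm_sym N f g : eqm N f g -> eqm N g f.
Proof. by move=> eqfg k /eqfg. Qed.
Lemma eqm_trans N g f h : eqm N f g -> eqm N g h -> eqm N f h.
Proof. by move=> eqfg eqgh k ltk; rewrite eqfg ?eqgh. Qed.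
Lemma eqm_le M N f g : (N <= M)%N -> eqm M f g -> eqm N f g.
Proof. by move=> leNM eqfg k ltk; apply: eqfg; apply: leq_trans leNM. Qed.
Lemma eqmD N f f' g g' : eqm N f f' -> eqm N g g' -> eqm N (f + g) (f' + g').
Proof. by move=> eqf eqg k ltk; rewrite !psD eqf ?eqg. Qed.
Lemma eqmN N f f' : eqm N f f' -> eqm N (- f) (- f').
Proof. by move=> eqf k ltk; rewrite !psN eqf. Qed.
Lemma eqmB N f f' g g' : eqm N f f' -> eqm N g g' -> eqm N (f - g) (f' - g').
Proof. by move=> eqf eqg; apply: eqmD => //; apply: eqmN. Qed.
Lemma eqmM N f f' g g' : eqm N f f' -> eqm N g g' -> eqm N (f * g) (f' * g').
Proof.
move=> eqf eqg k ltk; rewrite !psM; apply: eq_bigr => i _; congr (_ * _).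
  by apply: eqf; apply: leq_ltn_trans (leq_ord i) _.
by apply: eqg; apply: leq_ltn_trans (leq_subr _ _) _.
Qed.
Lemma eqmMl N f g g' : eqm N g g' -> eqm N (f * g) (f * g').
Proof. exact: eqmM. Qed.
Lemma eqmMr N f g g' : eqm N g g' -> eqm N (g * f) (g' * f).
Proof. by move=> eqg; apply: eqmM. Qed.
Lemma eqmXn N M f : (N <= M)%N -> eqm N (qX ^+ M * f) 0.
Proof. by move=> leNM k ltk; rewrite qXnM (leq_trans ltk). Qed.
Lemma eqm_sum N I (r : seq I) (P : pred I) (F G : I -> pser R) :
  (forall i, P i -> eqm N (F i) (G i)) ->
  eqm N (\sum_(i <- r | P i) F i) (\sum_(i <- r | P i) G i).
Proof. by move=> eqFG; elim/big_rec2: _ => // i x y Pi; apply: eqmD; apply: eqFG. Qed.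
Lemma eqm_eq f g : (forall N, eqm N f g) -> f = g.
Proof. by move=> eqfg; apply/funext => n; apply: (eqfg n.+1). Qed.

Lemma eqm_exp N f M : eqm 1 f 0 -> (N <= M)%N -> eqm N (f ^+ M) 0.
Proof.
by move=> /eqmP[c]; rewrite subr0 expr1 => -> leNM; rewrite exprMn; apply: eqmXn.
Qed.

End SeriesRing.

(** * Inverses of power series *)

Section SeriesUnit.
Variable R : comUnitRingType.
Implicit Types f g h : pser R.

Definition ps_unit : {pred pser R} := fun f => f 0%N \is a GRing.unit.
(** Geometric series of 1 - f / f(0). This has no constant term, so powers beyond the n-th do not
    reach the coefficient of q^n. *)
Definition ps_geom f : pser R :=
  fun n => (\sum_(k < n.+1) (1 - pconst (f 0%N)^-1 * f) ^+ k) n.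
Definition ps_inv f : pser R :=
  if ps_unit f then pconst (f 0%N)^-1 * ps_geom f else f.

Fact ps_mulVx : {in ps_unit, left_inverse 1 ps_inv *%R}.
Proof.
move=> f uf; rewrite /ps_inv (_ : ps_unit f) //.
set c := pconst _; set h := 1 - c * f.
have h0 : eqm 1 h 0.
  by case=> // _; rewrite /h psD psN ps1 psM0 /= mulVr // subrr.
have geomE N : eqm N (ps_geom f) (\sum_(k < N) h ^+ k).
  move=> k ltkN; rewrite /ps_geom -/c -/h -(subnKC ltkN) big_split_ord /=.
  rewrite psD [X in _ + X]ps_sum [X in _ + X]big1 ?addr0 // => i _.
  by rewrite (@eqm_exp _ k.+1 _ _ h0) ?ps0 // leq_addr.
apply: eqm_eq => N; rewrite mulrAC.
apply: (eqm_trans (eqmMl _ (geomE N))).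
rewrite [c * f](_ : _ = 1 - h); last by rewrite /h opprB addrC subrK.
rewrite -opprB mulNr -subrX1 opprB -[X in eqm _ _ X]subr0.
by apply: eqmB => //; apply: eqm_exp.
Qed.

Fact ps_unitPl f g : g * f = 1 -> ps_unit f.
Proof.
move/(congr1 (fun h : pser R => h 0%N)); rewrite psM0 /ps_unit => gf1.
by apply/unitrPr; exists (g 0%N); rewrite mulrC.
Qed.

Fact ps_inv_out : {in [predC ps_unit], ps_inv =1 id}.
Proof.
by move=> f; rewrite inE /ps_inv => /negbTE nuf; rewrite (_ : ps_unit f = false).
Qed.

HB.instance Definition _ := GRing.ComNzRing_hasMulInverse.Build (pser R)
  ps_mulVx ps_unitPl ps_inv_out.

Lemma ps_unitE f : (f \is a GRing.unit) = (f 0%N \is a GRing.unit).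
Proof. by []. Qed.

End SeriesUnit.

Section SeriesMap.
Variables (R S : comNzRingType) (h : {rmorphism R -> S}).

Definition psmap (f : pser R) : pser S := fun n => h (f n).

Fact psmap_is_zmod_morphism : zmod_morphism psmap.
Proof. by move=> f g; apply/funext => n; rewrite /psmap !psD !psN rmorphB. Qed.

Fact psmap_is_monoid_morphism : monoid_morphism psmap.
Proof.
split; first by apply/funext => n; rewrite /psmap !ps1 rmorph_nat.
move=> f g; apply/funext => n; rewrite /psmap !psM rmorph_sum.
by apply: eq_bigr => i _; rewrite rmorphM.
Qed.

HB.instance Definition _ := GRing.isZmodMorphism.Build (pser R) (pser S) psmap
  psmap_is_zmod_morphism.
HB.instance Definition _ := GRing.isMonoidMorphism.Build (pser R) (pser S) psmap
  psmap_is_monoid_morphism.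

Lemma psmapE f n : psmap f n = h (f n). Proof. by []. Qed.

Lemma psmap_qX : psmap (qX R) = qX S.
Proof. by apply/funext => n; rewrite /psmap /qX; case: ifP; rewrite ?rmorph1 ?rmorph0. Qed.

Lemma eqm_psmap N f g : eqm N f g -> eqm N (psmap f) (psmap g).
Proof. by move=> eqfg k /eqfg; rewrite /psmap => ->. Qed.

End SeriesMap.

(** * Laurent polynomials that are elliptic modulo a power of q *)

Section Congruence.
Variables (C : comNzRingType) (z : C).
Definition cg a b := exists c, a = b + z * c.
Lemma cg_refl a : cg a a. Proof. by exists 0; rewrite mulr0 addr0. Qed.
Lemma cgD a a' b b' : cg a a' -> cg b b' -> cg (a + b) (a' + b').
Proof. by move=> [c ->] [d ->]; exists (c + d); ring. Qed.
Lemma cgM a a' b b' : cg a a' -> cg b b' -> cg (a * b) (a' * b').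
Proof. by move=> [c ->] [d ->]; exists (a' * d + c * b' + z * c * d); ring. Qed.
Lemma cgN a a' : cg a a' -> cg (- a) (- a').
Proof. by move=> [c ->]; exists (- c); ring. Qed.
Lemma cgB a a' b b' : cg a a' -> cg b b' -> cg (a - b) (a' - b').
Proof. by move=> ca cb; apply: cgD => //; apply: cgN. Qed.
End Congruence.

Section Uniqueness.
Variable B : comNzRingType.
Implicit Types (q u v : B) (P : {poly B}).

Lemma coef_comp_scaleX P q n : (P \Po (q%:P * 'X))`_n = q ^+ n * P`_n.
Proof.
rewrite coef_comp_poly; under eq_bigr do rewrite exprMn -polyC_exp coefCM coefXn.
have [ltnP|leP] := ltnP n (size P); last first.
  rewrite nth_default // mulr0 big1 // => i _.
  by rewrite [n == _]gtn_eqF ?mulr0 // (leq_trans _ leP).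
rewrite (bigD1 (Ordinal ltnP)) //= eqxx mulr1 mulrC big1 ?addr0 // => i.
by rewrite -val_eqE /= eq_sym => /negbTE ->; rewrite !mulr0.
Qed.

(** Iterating the hypothesis [M] times gives f = q^(sM) f modulo q^M, and s M >= M. *)
Lemma self_congr_dvd q M s (f r : B) : (0 < s)%N -> f = q ^+ s * f + q ^+ M * r ->
  exists c, f = q ^+ M * c.
Proof.
move=> s_gt0 ef.
have [c ec] : exists c, f = q ^+ (s * M) * f + q ^+ M * c.
  elim: {1}M => [|m [c ec]]; first by exists 0; rewrite muln0 mul1r mulr0 addr0.
  exists (q ^+ (s * m) * r + c); rewrite {1}ec {1}ef mulnS exprD; ring.
exists (q ^+ (s.-1 * M) * f + c); rewrite {1}ec -{1}(prednK s_gt0) mulSn exprD; ring.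
Qed.

(** A term u^m with m < D lacks u^(D-m) to be a multiple of u^D; the extra q^(D-m) = (u v)^(D-m)
    supplies it. *)
Lemma horner_central P q u v D M : u * v = q ->
  (forall m, (D < m)%N -> exists c, P`_m = q ^+ M * c) ->
  (forall m, (m < D)%N -> exists c, P`_m = q ^+ (M + (D - m)) * c) ->
  exists c, P.[u] = u ^+ D * (P`_D + q ^+ M * c).
Proof.
move=> uvq Phi Plo.
have term m : exists c, P`_m * u ^+ m = u ^+ D * ((m == D)%:R * P`_D + q ^+ M * c).
  have [ltmD|gtmD|->] := ltngtP m D; last by exists 0; rewrite mulr0 addr0 mul1r mulrC.
    have [c ->] := Plo m ltmD; exists (v ^+ (D - m) * c).
    have -> : u ^+ D = u ^+ (D - m) * u ^+ m by rewrite -exprD subnK // ltnW.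
    have qE : q ^+ (D - m) = u ^+ (D - m) * v ^+ (D - m) by rewrite -exprMn uvq.
    by rewrite exprD qE /=; ring.
  have [c ->] := Phi m gtmD; exists (u ^+ (m - D) * c).
  have -> : u ^+ m = u ^+ (m - D) * u ^+ D by rewrite -exprD subnK // ltnW.
  by rewrite /=; ring.
have sumE n : exists c,
    \sum_(i < n) P`_i * u ^+ i = u ^+ D * ((D < n)%:R * P`_D + q ^+ M * c).
  elim: n => [|n [c ec]]; first by exists 0; rewrite big_ord0 ltn0 /=; ring.
  have [d ed] := term n; exists (c + d); rewrite big_ord_recr /= ec ed.
  by rewrite [(D < n.+1)%N]ltnS [(D <= n)%N]leq_eqVlt; case: (ltngtP n D) => /= _; ring.
have [c ec] := sumE (maxn (size P) D.+1); exists c.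
rewrite (@horner_coef_wide _ (maxn (size P) D.+1)) ?leq_maxl //.
by rewrite ec leq_maxr mul1r.
Qed.

(* [P = x^D F] and [P'] stands for [q x^D F(qx)], so the hypotheses say that [F(qx) = F(x)]
   modulo [q^(L-1)].  Comparing coefficients kills all of them but [P`_D]; the coefficient of
   [x^m] with [m < D] even gains a factor [q^(D-m)], which pays for the negative powers of [u]. *)
Lemma elliptic_const q u v D L P P' : GRing.lreg q -> (0 < D)%N -> (0 < L)%N ->
  u * v = q ->
  P \Po (q%:P * 'X) = q%:P ^+ D.-1 * P' -> cg (q%:P ^+ L) P' (q%:P * P) ->
  exists c, P.[u] = u ^+ D * (P`_D + q ^+ L.-1 * c).
Proof.
move=> q_reg D_gt0 L_gt0 uvq PqX [E eE].
have coefE m : q ^+ m * P`_m = q ^+ D.-1 * P'`_m.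
  by rewrite -coef_comp_scaleX PqX -polyC_exp coefCM.
have P'E m : P'`_m = q * P`_m + q ^+ L * E`_m.
  by rewrite eE coefD -polyC_exp !coefCM.
apply: (horner_central uvq) => m lt.
  (* Cancelling q^D here leaves an error in q^(L-1) only: one power is lost against the factor [q]
     of [q * P]. *)
  apply: (@self_congr_dvd _ _ (m - D) _ (- E`_m)); first by rewrite subn_gt0.
  apply: (q_reg); apply: (@lregX _ _ D.-1 q_reg); rewrite /=.
  have -> : q * (q ^+ (m - D) * P`_m + q ^+ L.-1 * - E`_m) =
    q ^+ (m - D).+1 * P`_m - q ^+ L * E`_m by rewrite -{2}(prednK L_gt0) !exprS; ring.
  rewrite mulrBr [in RHS]mulrA -exprD.
  have -> : (D.-1 + (m - D).+1 = m)%N by lia.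
  rewrite coefE P'E; ring.
have eP : P`_m = q ^+ (D.-1 - m) * P'`_m.
  apply: (@lregX _ _ m q_reg); rewrite /= coefE mulrA -exprD; congr (_ ^+ _ * _); lia.
apply: (@self_congr_dvd _ _ (D - m) _ (E`_m)); first by rewrite subn_gt0.
rewrite {1}eP P'E mulrDr !mulrA -exprSr -exprD.
by congr (_ ^+ _ * _ + _ ^+ _ * _); lia.
Qed.

(* Here [F(qx) = -F(x)/x], so the coefficients of [F] are all determined by a single one. *)
Lemma theta_zero q u v D L P P' : GRing.lreg q -> u * v = q ->
  P \Po (q%:P * 'X) = q%:P ^+ D * P' -> cg (q%:P ^+ L) ('X * P') (- P) ->
  P`_D = 0 -> exists c, P.[u] = u ^+ D * (q ^+ L * c).
Proof.
move=> q_reg uvq PqX [E eE] PD0.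
have coefE m : q ^+ m * P`_m = q ^+ D * P'`_m.
  by rewrite -coef_comp_scaleX PqX -polyC_exp coefCM.
have stepE m : P'`_m = - P`_m.+1 + q ^+ L * E`_m.+1.
  by have := congr1 (fun p : {poly B} => p`_m.+1) eE;
      rewrite coefXM coefD coefN -polyC_exp coefCM.
have hi k : exists c, P`_(D + k) = q ^+ L * c.
  elim: k => [|k [c ec]]; first by exists 0; rewrite addn0 PD0 mulr0.
  have eP' : P'`_(D + k) = q ^+ (L + k) * c.
    apply: (@lregX _ _ D q_reg); rewrite /= -coefE ec !mulrA -!exprD.
    by congr (_ ^+ _ * _); lia.
  exists (E`_(D + k).+1 - q ^+ k * c); rewrite addnS.
  have := stepE (D + k)%N; rewrite eP' exprD => e.
  have -> : P`_(D + k).+1 = q ^+ L * E`_(D + k).+1 - (- P`_(D + k).+1 + q ^+ L * E`_(D +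
      k).+1) by ring.
  by rewrite -e; ring.
(* Going down, the step to [D - k.+1] multiplies by q^(k+1); this is the gain that [horner_central]
   demands below [D]. *)
have lo k : (k <= D)%N -> exists c, P`_(D - k) = q ^+ (L + k) * c.
  elim: k => [|k IH] lek; first by exists 0; rewrite subn0 PD0 mulr0.
  have [c ec] := IH (ltnW lek).
  have : P`_(D - k.+1) = q ^+ k.+1 * P'`_(D - k.+1).
    apply: (@lregX _ _ (D - k.+1) q_reg); rewrite /= coefE mulrA -exprD.
    by congr (_ ^+ _ * _); lia.
  rewrite stepE (_ : (D - k.+1).+1 = (D - k)%N); last by lia.
  rewrite ec => ->; exists (- (q ^+ k * c) + E`_(D - k)).
  by rewrite !exprD; ring.
have [c ->] : exists c, P.[u] = u ^+ D * (P`_D + q ^+ L * c).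
  apply: (horner_central uvq) => m lt.
    by have [c] := hi (m - D)%N; rewrite subnKC ?(ltnW lt) //; exists c.
  by have [c] := lo (D - m)%N (leq_subr _ _); rewrite subKn ?(ltnW lt) //; exists c.
by exists c; rewrite PD0 add0r.
Qed.

End Uniqueness.

(** * Truncated universal mock theta functions *)

Section Lerch.
Variable C : comNzRingType.
Implicit Types (q x a c w : C).

(** With b = c / w this is w^n (a;q)_n (b;q)_n. The homogeneous factor [w - c * q ^+ i] avoids the
    division: at a = w = x and c = q one gets a polynomial truncation of x^n j(x;q) / (q;q)_oo. *)
Definition jprod q a c w n := \prod_(i < n) ((1 - a * q ^+ i) * (w - c * q ^+ i)).

(* With [b = c / w], this is [w^n (a;q)_n (b;q)_n] times the partial sum of
   [q^(k(k+1)) / ((a;q)_(k+1) (b;q)_(k+1))] over [k < n], which is g(a;q) when [ab = q]. *)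
Fixpoint lerch q a c w n :=
  if n is n'.+1 then
    lerch q a c w n' * ((1 - a * q ^+ n') * (w - c * q ^+ n')) +
    w ^+ n * q ^+ (n' * n)
  else 0.

(* [lerch] at [qa] and [b/q]; the factor [1 - b/q] never occurs, hence the harmless [0.-1]. *)
Fixpoint lerchS q a c w n :=
  if n is n'.+1 then
    lerchS q a c w n' * ((1 - a * q ^+ n) * (w - c * q ^+ n'.-1)) +
    w ^+ n * q ^+ (n' * n)
  else 0.

Lemma jprodS q a c w n : jprod q a c w n.+1 =
  jprod q a c w n * ((1 - a * q ^+ n) * (w - c * q ^+ n)).
Proof. by rewrite /jprod big_ord_recr. Qed.

(* The terms t_n of g satisfy t_n(qx) + x^3 t_n(x) = -x(1 - x^2)(v_n - v_(n+1)) with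
   v_n = t_n (1 - q^(n+1) / x), so that the functional equation of g telescopes. *)
Lemma lerch_shift (al ga w : C) n (q := al * ga) (y := al * w) :
  (w - ga * q ^+ n) * lerchS q y ga w n.+1 =
  w * ((1 - y * q ^+ n.+1) *
         (y ^+ 2 * lerch q y ga w n.+1 + (1 + y) * jprod q y ga w n.+1) -
       (1 - y ^+ 2) * (w ^+ n.+1 * q ^+ (n.+1 * n.+2))).
Proof.
(* Writing q = al ga and y = al w makes ab = q hold for a = y and b = ga / w without dividing by
   [w]. *)
elim: n => [|n IH].
  by rewrite /jprod big_ord1 /= /y /q; ring.
have qS m : q ^+ m.+1 = al * ga * q ^+ m by rewrite exprS.
have qq : q ^+ (n.+2 * n.+3) = q ^+ (n.+1 * n.+2) * (q ^+ n.+2) ^+ 2.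
  by rewrite -exprM -exprD; congr (_ ^+ _); lia.
have -> : lerchS q y ga w n.+2 = lerchS q y ga w n.+1 *
   ((1 - y * q ^+ n.+2) * (w - ga * q ^+ n)) + w ^+ n.+2 * q ^+ (n.+1 * n.+2) by [].
have -> : lerch q y ga w n.+2 = lerch q y ga w n.+1 *
   ((1 - y * q ^+ n.+1) * (w - ga * q ^+ n.+1)) + w ^+ n.+2 * q ^+ (n.+1 * n.+2) by [].
rewrite jprodS qq mulrDr [X in X + _ = _](_ : _ =
  (w - ga * q ^+ n.+1) * (1 - y * q ^+ n.+2) *
  ((w - ga * q ^+ n) * lerchS q y ga w n.+1)); last by ring.
rewrite IH; move: (lerch _ _ _ _ _) (jprod _ _ _ _ _) (q ^+ (n.+1 * n.+2)) => T J z.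
rewrite [w ^+ n.+2]exprS !qS.
move: (q ^+ n) (w ^+ n.+1) => s t; rewrite /y; ring.
Qed.

Lemma lerchZ (l : C) q a c w n : lerch q a (l * c) (l * w) n = l ^+ n * lerch q a c w n.
Proof.
elim: n => [|n IH] /=; first by rewrite mulr0.
rewrite IH exprMn exprS; move: (lerch _ _ _ _ _) (q ^+ n) (q ^+ (n * n.+1)) => T s z; ring.
Qed.

Lemma lerchSZ (l : C) q a c c' w n : c' * q = l * c ->
  lerch q (q * a) c' (l * w) n = l ^+ n * lerchS q a c w n.
Proof.
move=> cc'; elim: n => [|[|n] IH] /=; rewrite ?mulr0 //.
  by rewrite !mul0r !add0r !expr1 !expr0 !mulr1.
move: IH => /= ->.
have -> : l * w - c' * q ^+ n.+1 = l * (w - c * q ^+ n).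
  by rewrite [q ^+ n.+1]exprS mulrA cc'; ring.
rewrite [l ^+ n.+2]exprS exprMn [l ^+ n.+2]exprS [q ^+ n.+2]exprS.
move: (_ + w ^+ _ * _) => T; ring.
Qed.

End Lerch.

Section LerchMorph.
Variables (C C' : comNzRingType) (h : {rmorphism C -> C'}).
Lemma rmorph_jprod q a c w n : h (jprod q a c w n) = jprod (h q) (h a) (h c) (h w) n.
Proof.
rewrite rmorph_prod; apply: eq_bigr => i _.
by rewrite rmorphM !rmorphB !rmorphM !rmorphXn rmorph1.
Qed.
Lemma rmorph_lerch q a c w n : h (lerch q a c w n) = lerch (h q) (h a) (h c) (h w) n.
Proof.
elim: n => [|n IH]; first exact: rmorph0.
by rewrite /= -IH rmorphD !rmorphM !rmorphB !rmorphM !rmorphXn rmorph1.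
Qed.
End LerchMorph.

(** * The elliptic combination of mock theta functions *)

Section Elliptic.
Variables (C : comNzRingType) (L : nat).
Implicit Types q x : C.

Definition upper q x n e := \prod_(i < n) (1 + q ^+ (4 * i + e) * x ^+ 2).
Definition lower q x n e := \prod_(i < n) (x ^+ 2 + q ^+ (4 * i + e)).
(** [theta1] and [theta3] truncate j(-q x^2;q^4) and j(-q^3 x^2;q^4), up to a power of x and the
    factor (q^4;q^4)_oo. The unequal lengths make the shift from [theta3] to [theta1] exact: at qx
    the first factor of [lower] becomes q (1 + q x^2), the first factor of [upper] in [theta1]. *)
Definition theta1 q x := upper q x L.+1 1 * lower q x L 3.
Definition theta3 q x := upper q x L 3 * lower q x L.+1 1.
(** [lerch1] and [lerch3] are [theta1] and [theta3] times partial sums of g(-q x^2;q^4) and g(-q^3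
    x^2;q^4). The factor in front is the one by which the theta product is longer than the [jprod]
    matching [lerch]. *)
Definition lerch1 q x := (1 + q ^+ (4 * L + 1) * x ^+ 2) *
  lerch (q ^+ 4) (- (q * x ^+ 2)) (- q ^+ 3) (x ^+ 2) L.
Definition lerch3 q x := (x ^+ 2 + q ^+ (4 * L + 1)) *
  lerch (q ^+ 4) (- (q ^+ 3 * x ^+ 2)) (- q) (x ^+ 2) L.
(* [x^(5L+4)] times the truncation of
   j(x;q) j(-q x^2;q^2) (1 + x g(x;q) + q x g(-q x^2;q^4) - q x^(-2) g(-q^3 x^2;q^4)),
   where j(-q x^2;q^2) is split into its factors [theta1] and [theta3] over base q^4;
   [ellips] is the same expression at [qx], up to a power of [q]. *)
Definition ellip q x :=
  x ^+ 2 * jprod q x q x L * theta1 q x * theta3 q x +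
  x ^+ 3 * lerch q x q x L * theta1 q x * theta3 q x +
  q * x ^+ 3 * jprod q x q x L * lerch1 q x * theta3 q x -
  q * jprod q x q x L * theta1 q x * lerch3 q x.

Definition jshift q x := \prod_(i < L) ((1 - x * q ^+ i.+1) * (x - q ^+ i)).
Definition theta1s q x := upper q x L.+1 3 * lower q x L 1.
Definition lerch1s q x := (1 + q ^+ (4 * L + 3) * x ^+ 2) *
  lerch (q ^+ 4) (- (q ^+ 3 * x ^+ 2)) (- q) (x ^+ 2) L.
Definition lerch3s q x := (x ^+ 2 + q ^+ (4 * L.-1 + 3)) *
  lerchS (q ^+ 4) (- (q * x ^+ 2)) (- q ^+ 3) (x ^+ 2) L.
Definition ellips q x :=
  x ^+ 2 * jshift q x * theta1s q x * theta1 q x +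
  q * x ^+ 3 * lerchS q x q x L * theta1s q x * theta1 q x +
  q ^+ 2 * x ^+ 3 * jshift q x * lerch1s q x * theta1 q x -
  jshift q x * theta1s q x * lerch3s q x.

Lemma jprod_qx q x : jprod q (q * x) q (q * x) L = q ^+ L * jshift q x.
Proof.
rewrite -[L in q ^+ L]card_ord -prodr_const -big_split /=.
by apply: eq_bigr => i _; rewrite exprS; ring.
Qed.

Lemma upper_qx q x n e : upper q (q * x) n e = upper q x n (e + 2).
Proof. by apply: eq_bigr => i _; rewrite addnA [q ^+ (_ + 2)]exprD; ring. Qed.

Lemma lower_qx q x n e : lower q (q * x) n (e + 2) = q ^+ (2 * n) * lower q x n e.
Proof.
rewrite exprM -[n in _ ^+ n]card_ord -prodr_const -big_split /=.
by apply: eq_bigr => i _; rewrite addnA [q ^+ (_ + 2)]exprD; ring.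
Qed.

Lemma theta1_qx q x : theta1 q (q * x) = q ^+ (2 * L) * theta1s q x.
Proof. by rewrite /theta1 upper_qx (lower_qx q x L 1) /theta1s; ring. Qed.

Lemma theta3_qx q x : theta3 q (q * x) = q ^+ (2 * L + 1) * theta1 q x.
Proof.
rewrite /theta3 /theta1 upper_qx {1}/lower big_ord_recl /=.
have -> : \prod_(i < L) ((q * x) ^+ 2 + q ^+ (4 * bump 0 i + 1)) = lower q (q * x) L (3 + 2).
  by apply: eq_bigr => i _; rewrite /bump /=; congr (_ + _ ^+ _); lia.
rewrite lower_qx.
have -> : upper q x L.+1 1 = (1 + q * x ^+ 2) * upper q x L (3 + 2).
  rewrite /upper big_ord_recl /=; congr (_ * _).
  by apply: eq_bigr => i _; rewrite /bump /=; congr (_ + _ ^+ _ * _); lia.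
rewrite muln0 expr1 [q ^+ (2 * L + 1)]exprD expr1. ring.
Qed.

Lemma lerch1_qx q x : lerch1 q (q * x) = q ^+ (2 * L) * lerch1s q x.
Proof.
rewrite /lerch1 /lerch1s exprMn [q ^+ (2 * L)]exprM.
have -> : - q ^+ 3 = q ^+ 2 * - q by ring.
have -> : - (q * (q ^+ 2 * x ^+ 2)) = - (q ^+ 3 * x ^+ 2) by ring.
by rewrite lerchZ !exprD; ring.
Qed.

Lemma lerch3_qx q x : (0 < L)%N -> lerch3 q (q * x) = q ^+ (2 * L + 2) * lerch3s q x.
Proof.
move=> L_gt0; rewrite /lerch3 /lerch3s exprMn [q ^+ (2 * L + 2)]exprD exprM.
have -> : - (q ^+ 3 * (q ^+ 2 * x ^+ 2)) = q ^+ 4 * - (q * x ^+ 2) by ring.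
rewrite (@lerchSZ _ (q ^+ 2) _ _ (- q ^+ 3)); last by ring.
have -> : (4 * L + 1 = (4 * L.-1 + 3) + 2)%N by lia.
by rewrite [q ^+ (_ + 2)]exprD; ring.
Qed.

Lemma ellip_qx q x : (0 < L)%N -> ellip q (q * x) = q ^+ (5 * L + 3) * ellips q x.
Proof.
move=> L_gt0; rewrite /ellip jprod_qx theta1_qx theta3_qx lerch1_qx lerch3_qx //.
rewrite (@lerchSZ _ q _ _ q) //.
have -> : q ^+ (5 * L + 3) = q ^+ 3 * q ^+ L * q ^+ (2 * L) * q ^+ (2 * L).
  by rewrite -!exprD; congr (_ ^+ _); lia.
rewrite !exprD /ellips; ring.
Qed.

(** Truncated form of j(qx;q) = -j(x;q)/x: the two products differ in their end factors only. *)
Lemma jshiftE q x : (x - q ^+ L) * jshift q x = - ((1 - x * q ^+ L) * jprod q x q x L).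
Proof.
rewrite /jshift /jprod; move: L => n; elim: n => [|n IH]; first by rewrite !big_ord0; ring.
rewrite !big_ord_recr /= [LHS](_ : _ =
  ((x - q ^+ n) * \prod_(i < n) ((1 - x * q ^+ i.+1) * (x - q ^+ i))) *
  ((x - q ^+ n.+1) * (1 - x * q ^+ n.+1))); last by ring.
by rewrite IH exprS; ring.
Qed.

Lemma theta1sE q x : (x ^+ 2 + q ^+ (4 * L + 1)) * theta1s q x =
  theta3 q x * (1 + q ^+ (4 * L + 3) * x ^+ 2).
Proof.
rewrite /theta1s /theta3 /upper /lower.
rewrite [\prod_(i < L.+1) (1 + _)]big_ord_recr [\prod_(i < L.+1) (_ + _)]big_ord_recr /=.
ring.
Qed.

Lemma lerch1sE q x : (x ^+ 2 + q ^+ (4 * L + 1)) * lerch1s q x =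
  lerch3 q x * (1 + q ^+ (4 * L + 3) * x ^+ 2).
Proof. by rewrite /lerch1s /lerch3; ring. Qed.

Lemma jprod_theta1 q x : theta1 q x =
  (1 + q ^+ (4 * L + 1) * x ^+ 2) * jprod (q ^+ 4) (- (q * x ^+ 2)) (- q ^+ 3) (x ^+ 2) L.
Proof.
rewrite /theta1 /upper /lower big_ord_recr /= /jprod big_split /=.
have -> : \prod_(i < L) (1 + q ^+ (4 * i + 1) * x ^+ 2) =
          \prod_(i < L) (1 - - (q * x ^+ 2) * q ^+ 4 ^+ i).
  by apply: eq_bigr => i _; rewrite -exprM exprD; ring.
have -> : \prod_(i < L) (x ^+ 2 + q ^+ (4 * i + 3)) =
          \prod_(i < L) (x ^+ 2 - - q ^+ 3 * q ^+ 4 ^+ i).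
  by apply: eq_bigr => i _; rewrite -exprM exprD; ring.
ring.
Qed.

Lemma jshift_congr q x : cg (q ^+ L) (x * jshift q x) (- jprod q x q x L).
Proof.
exists (jshift q x + x * jprod q x q x L).
have -> : x * jshift q x = (x - q ^+ L) * jshift q x + q ^+ L * jshift q x by ring.
by rewrite jshiftE; ring.
Qed.

Lemma theta1s_congr q x : cg (q ^+ (4 * L + 1)) (x ^+ 2 * theta1s q x) (theta3 q x).
Proof.
exists (theta3 q x * q ^+ 2 * x ^+ 2 - theta1s q x).
have -> : x ^+ 2 * theta1s q x =
  (x ^+ 2 + q ^+ (4 * L + 1)) * theta1s q x - q ^+ (4 * L + 1) * theta1s q x by ring.
by rewrite theta1sE (_ : 4 * L + 3 = 4 * L + 1 + 2)%N ?exprD -?addnA //; ring.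
Qed.

End Elliptic.

Section EllipticShift.
Variables (C : comNzRingType) (l : nat).
Implicit Types q x : C.
Local Notation L := l.+1.

(** Functional equation of g(y;q^4) at y = -q x^2, from [lerch_shift] with al = -q, ga = -q^3 and w
    = x^2. The term in q^(4L(L+1)) is the truncation error. *)
Lemma lerch3sE q x : lerch3s L q x = x ^+ 2 *
  (q ^+ 2 * x ^+ 4 * lerch1 L q x + (1 - q * x ^+ 2) * theta1 L q x -
   (1 - q ^+ 2 * x ^+ 4) * ((x ^+ 2) ^+ L * q ^+ (4 * (L * L.+1)))).
Proof.
rewrite jprod_theta1 /lerch3s /lerch1 [L.-1]/=.
have := lerch_shift (- q) (- q ^+ 3) (x ^+ 2) l.
have -> : - q * - q ^+ 3 = q ^+ 4 by ring.
have -> : - q * x ^+ 2 = - (q * x ^+ 2) by ring.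
have -> : q ^+ (4 * l + 3) = q ^+ 3 * q ^+ 4 ^+ l by rewrite exprD exprM mulrC.
have -> : q ^+ (4 * L + 1) = q * q ^+ 4 ^+ L by rewrite exprD exprM mulrC.
rewrite [q ^+ (4 * (_ * _))]exprM => e.
have -> : x ^+ 2 + q ^+ 3 * q ^+ 4 ^+ l = x ^+ 2 - - q ^+ 3 * q ^+ 4 ^+ l by ring.
rewrite e. ring.
Qed.

Lemma lerchS_E q x : (x - q ^+ L) * lerchS q x q x L =
  x * ((1 - x * q ^+ L) * (x ^+ 2 * lerch q x q x L + (1 + x) * jprod q x q x L) -
       (1 - x ^+ 2) * (x ^+ L * q ^+ (L * L.+1))).
Proof. by have := lerch_shift 1 q x l; cbv zeta; rewrite !mul1r -exprS. Qed.

(** Each shifted factor is congruent to an unshifted one after multiplication by x or x^2; the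
    common factor x^3 pays for this. *)
Lemma ellips_congr q x : cg (q ^+ L) (x ^+ 3 * ellips L q x) (x ^+ 3 * (q * ellip L q x)).
Proof.
set z := q ^+ L.
have cgj := jshift_congr L q x.
have cgT : cg z (x * lerchS q x q x L)
    (x * (x ^+ 2 * lerch q x q x L + (1 + x) * jprod q x q x L)).
  exists (lerchS q x q x L - x * x * (x ^+ 2 * lerch q x q x L + (1 + x) * jprod q x q x L)
          - x * (1 - x ^+ 2) * x ^+ L * q ^+ (L * L)).
  have -> : x * lerchS q x q x L = (x - z) * lerchS q x q x L + z * lerchS q x q x L by ring.
  rewrite lerchS_E -/z mulnS exprD -/z; ring.
have zM e : (L <= e)%N -> q ^+ e = z * q ^+ (e - L) by move=> leLe; rewrite -exprD subnKC.
have cgt : cg z (x ^+ 2 * theta1s L q x) (theta3 L q x).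
  have [c ->] := theta1s_congr L q x; rewrite zM; last by lia.
  by rewrite -mulrA; eexists.
have cgu : cg z (x ^+ 2 * lerch1s L q x) (lerch3 L q x).
  have := lerch1sE L q x; rewrite (zM (4 * L + 1)%N) ?(zM (4 * L + 3)%N); try lia.
  move: (q ^+ _) (q ^+ _) => t s e.
  exists (lerch3 L q x * t * x ^+ 2 - s * lerch1s L q x).
  have -> : x ^+ 2 * lerch1s L q x =
      (x ^+ 2 + z * s) * lerch1s L q x - z * s * lerch1s L q x by ring.
  by rewrite e; ring.
have cgv : cg z (lerch3s L q x)
    (x ^+ 2 * (q ^+ 2 * x ^+ 4 * lerch1 L q x + (1 - q * x ^+ 2) * theta1 L q x)).
  rewrite lerch3sE (zM (4 * (L * L.+1))%N); last by lia.
  move: (q ^+ (_ - _)) => s.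
  by exists (- (x ^+ 2 * (1 - q ^+ 2 * x ^+ 4) * (x ^+ 2) ^+ L * s)); ring.
have -> : x ^+ 3 * ellips L q x =
  x ^+ 2 * (x * jshift L q x) * (x ^+ 2 * theta1s L q x) * theta1 L q x +
  q * x ^+ 3 * (x * lerchS q x q x L) * (x ^+ 2 * theta1s L q x) * theta1 L q x +
  q ^+ 2 * x ^+ 3 * (x * jshift L q x) * (x ^+ 2 * lerch1s L q x) * theta1 L q x -
  (x * jshift L q x) * (x ^+ 2 * theta1s L q x) * lerch3s L q x by rewrite /ellips; ring.
set J := jprod q x q x L in cgj cgT *; set T := lerch q x q x L in cgT *.
(* The inhomogeneous parts and the shifted constant 1 contribute -x^2 + q x^4 (1 + x) + x^2 (1 - q
   x^2) = q x^5 times [J], [theta1] and [theta3]: the constant 1 of H reappears. *)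
have -> : x ^+ 3 * (q * ellip L q x) =
  x ^+ 2 * - J * theta3 L q x * theta1 L q x +
  q * x ^+ 3 * (x * (x ^+ 2 * T + (1 + x) * J)) * theta3 L q x * theta1 L q x +
  q ^+ 2 * x ^+ 3 * - J * lerch3 L q x * theta1 L q x -
  (- J) * theta3 L q x *
  (x ^+ 2 * (q ^+ 2 * x ^+ 4 * lerch1 L q x + (1 - q * x ^+ 2) * theta1 L q x)).
  by rewrite /ellip -/J -/T; ring.
by apply: cgB; [apply: cgD; [apply: cgD|]|]; repeat (apply: cgM => //);
   try exact: cg_refl.
Qed.

End EllipticShift.

Section EllipticMorph.
Variables (C C' : comNzRingType) (h : {rmorphism C -> C'}).

Lemma rmorph_upper q x n e : h (upper q x n e) = upper (h q) (h x) n e.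
Proof.
by rewrite rmorph_prod; apply: eq_bigr => i _; rewrite rmorphD rmorphM !rmorphXn rmorph1.
Qed.

Lemma rmorph_lower q x n e : h (lower q x n e) = lower (h q) (h x) n e.
Proof. by rewrite rmorph_prod; apply: eq_bigr => i _; rewrite rmorphD !rmorphXn. Qed.

Lemma rmorph_theta1 L q x : h (theta1 L q x) = theta1 L (h q) (h x).
Proof. by rewrite /theta1 /theta3 rmorphM rmorph_upper rmorph_lower. Qed.

Lemma rmorph_theta3 L q x : h (theta3 L q x) = theta3 L (h q) (h x).
Proof. by rewrite /theta1 /theta3 rmorphM rmorph_upper rmorph_lower. Qed.

Lemma rmorph_ellip L q x : h (ellip L q x) = ellip L (h q) (h x).
Proof.
rewrite /ellip /lerch1 /lerch3.
rewrite !(rmorph_theta1, rmorph_theta3, rmorphXn, rmorphB, rmorphD, rmorphN, rmorphM, rmorph1).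
by rewrite !(rmorph_jprod, rmorph_lerch) !(rmorphN, rmorphM, rmorphXn).
Qed.
End EllipticMorph.

(** The constant [c], the coefficient of x^(5L+4), is fixed before the point [u]; hence values at
    different points can be compared. *)
Lemma ellip_eval (B : comNzRingType) (L : nat) (q : B) : GRing.lreg q -> (0 < L)%N ->
  exists c, forall u t, u ^+ 2 * t = q ->
  exists d, ellip L q u = u ^+ (5 * L + 4) * (c + q ^+ L.-1 * d).
Proof.
move=> q_reg; case: L => // l _; set L := l.+1.
pose P : {poly B} := ellip L q%:P 'X; pose P' : {poly B} := ellips L q%:P 'X.
exists P`_(5 * L + 4) => u t uut.
have -> : ellip L q u = P.[u].
  by rewrite /P -[P.[u]]/(horner_eval u P) rmorph_ellip /= /horner_eval hornerC hornerX.
apply: (@elliptic_const _ q u (u * t) (5 * L + 4) L P P') => //; try lia.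
- by rewrite -uut; ring.
- rewrite -[LHS]/(comp_poly (q%:P * 'X) P) rmorph_ellip /= comp_polyC comp_polyX.
  rewrite ellip_qx //; congr (_ ^+ _ * _); lia.
have [E eE] := ellips_congr l q%:P ('X : {poly B}).
(* The factor x^3 of [ellips_congr] is cancelled by reading coefficients three places higher. *)
exists (drop_poly 3 E); apply/polyP => m.
have := congr1 (fun p : {poly B} => p`_(m + 3)) eE.
rewrite coefD ![_ ^+ 3 * _]mulrC -polyC_exp coefCM !coefMXn -/L ltnNge leq_addl /= addnK => ->.
by rewrite coefD !coefCM coef_drop_poly.
Qed.

(** * Evaluation of the elliptic identity *)

Section Pochhammer.
Variable C : comNzRingType.
Implicit Types q x y : C.

Definition poch q x n := \prod_(i < n) (1 - x * q ^+ i).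

Lemma pochS q x n : poch q x n.+1 = poch q x n * (1 - x * q ^+ n).
Proof. by rewrite /poch big_ord_recr. Qed.

Lemma poch_recl q x n : poch q x n.+1 = (1 - x) * poch q (q * x) n.
Proof.
rewrite /poch big_ord_recl /= expr0 mulr1; congr (_ * _).
by apply: eq_bigr => i _; rewrite /bump /= exprS; ring.
Qed.

Lemma jprod_poch q x y n : jprod q x y 1 n = poch q x n * poch q y n.
Proof. exact: big_split. Qed.

Lemma jprodZ (l : C) q a c w n : jprod q a (l * c) (l * w) n = l ^+ n * jprod q a c w n.
Proof.
rewrite -[n in l ^+ n]card_ord -prodr_const -big_split /=.
by apply: eq_bigr => i _; ring.
Qed.

Lemma lerch_prod q a c w n : lerch q a c w n =
  \sum_(k < n) w ^+ k.+1 * q ^+ (k * k.+1) *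
     \prod_(k.+1 <= i < n) ((1 - a * q ^+ i) * (w - c * q ^+ i)).
Proof.
elim: n => [|n IH]; first by rewrite big_ord0.
rewrite big_ord_recr /= [in X in _ = _ + X]big_geq // mulr1 IH mulr_suml; congr (_ + _).
by apply: eq_bigr => k _; rewrite big_nat_recr ?ltn_ord //= -!mulrA.
Qed.

End Pochhammer.

Section ThetaPoch.
Variables (C : comNzRingType) (n : nat) (q u t : C).
Hypothesis uut : u ^+ 2 * t = q.

Let upper1 k : upper q u k 1 = poch (q ^+ 4) (- (q * u ^+ 2)) k.
Proof. by apply: eq_bigr => i _; rewrite exprD exprM; ring. Qed.

Let upper3 k : upper q u k 3 = poch (q ^+ 4) (- (q ^+ 3 * u ^+ 2)) k.
Proof. by apply: eq_bigr => i _; rewrite exprD exprM; ring. Qed.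

Let lower1 k : lower q u k 1 = u ^+ (2 * k) * poch (q ^+ 4) (- t) k.
Proof.
rewrite exprM -[k in _ ^+ k]card_ord -prodr_const -big_split /=.
by apply: eq_bigr => i _; rewrite exprD exprM expr1 -[in X in _ + X](uut) -uut; ring.
Qed.

Let lower3 k : lower q u k 3 = u ^+ (2 * k) * poch (q ^+ 4) (- (q ^+ 2 * t)) k.
Proof.
rewrite exprM -[k in _ ^+ k]card_ord -prodr_const -big_split /=.
apply: eq_bigr => i _.
have -> : q ^+ (4 * i + 3) = q ^+ 4 ^+ i * q ^+ 2 * (u ^+ 2 * t).
  by rewrite uut -exprM -!exprD -exprSr; congr (_ ^+ _); lia.
by ring.
Qed.

Lemma theta1_poch : theta1 n q u =
  u ^+ (2 * n) * (poch (q ^+ 4) (- (q * u ^+ 2)) n.+1 * poch (q ^+ 4) (- (q ^+ 2 * t)) n).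
Proof. by rewrite /theta1 upper1 lower3; ring. Qed.

Lemma theta3_poch : theta3 n q u =
  u ^+ (2 * n + 2) * (poch (q ^+ 4) (- (q ^+ 3 * u ^+ 2)) n * poch (q ^+ 4) (- t) n.+1).
Proof.
by rewrite /theta3 upper3 lower1 (_ : 2 * n.+1 = 2 * n + 2)%N; [ring | lia].
Qed.

Lemma jprod_diag : jprod q u q u n = u ^+ n * (poch q u n * poch q (u * t) n).
Proof.
by rewrite -jprod_poch -jprodZ mulr1; congr (jprod _ _ _ _ _); rewrite -uut; ring.
Qed.

End ThetaPoch.

Section LerchSeries.
Variable C : comUnitRingType.
Implicit Types q x y : C.

Lemma fracE (a b c : C) : b \is a GRing.unit -> c \is a GRing.unit ->
  (a * c) / (b * c) = a / b.
Proof. by move=> ub uc; rewrite invrM // mulrA mulrK. Qed.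

(** Partial sum of the symmetric form of g(x;q) when x y = q. Exchanging [x] and [y] is the symmetry
    g(x;q) = g(q/x;q). *)
Definition gser q x y n := \sum_(k < n) q ^+ (k * k.+1) / (poch q x k.+1 * poch q y k.+1).

Lemma lerch_gser q x y n :
  (forall k, (k <= n)%N -> poch q x k * poch q y k \is a GRing.unit) ->
  lerch q x y 1 n = poch q x n * poch q y n * gser q x y n.
Proof.
elim: n => [|n IH] unitP; first by rewrite /gser big_ord0 mulr0.
rewrite /= IH => [|k lekn]; last by apply: unitP; apply: leqW.
rewrite /gser big_ord_recr /= [in RHS]mulrDr expr1n mul1r; congr (_ + _).
  by rewrite !pochS; ring.
by rewrite mulrCA divrr ?mulr1 ?unitP.
Qed.

(** Telescoping from the defining series to the symmetric one: over a common denominator, (1 - y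
    q^n) + x y q^(2n) - (1 - x q^n)(1 - y q^n) = x q^n. *)
Lemma rank_gser q x y n : x * y = q ->
  (forall k, (k <= n)%N -> poch q x k * poch q y k \is a GRing.unit) ->
  \sum_(k < n) q ^+ (k ^ 2) / (poch q x k.+1 * poch q y k) =
  1 + x * gser q x y n - q ^+ (n ^ 2) / (poch q x n * poch q y n).
Proof.
move=> xyq; elim: n => [|n IH] unitP.
  by rewrite /gser !big_ord0 /poch !big_ord0 expr0 mulr1 divr1; ring.
rewrite big_ord_recr /= IH => [|k lekn]; last by apply: unitP; apply: leqW.
rewrite /gser [in RHS]big_ord_recr /= -/(gser q x y n).
have := unitP n.+1 (leqnn _); rewrite unitrM => /andP[ux uy].
have /andP[ux' uxn] : (poch q x n \is a GRing.unit) && (1 - x * q ^+ n \is a GRing.unit).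
  by rewrite -unitrM -pochS.
have /andP[uy' uyn] : (poch q y n \is a GRing.unit) && (1 - y * q ^+ n \is a GRing.unit).
  by rewrite -unitrM -pochS.
have -> : q ^+ (n * n.+1) = q ^+ (n ^ 2) * q ^+ n by rewrite -exprD; congr (_ ^+ _); lia.
have -> : q ^+ (n.+1 ^ 2) = q ^+ (n ^ 2) * (x * y * q ^+ n ^+ 2).
  by rewrite xyq -exprM -exprS -exprD; congr (_ ^+ _); lia.
have -> : q ^+ (n ^ 2) / (poch q x n.+1 * poch q y n) =
    q ^+ (n ^ 2) * (1 - y * q ^+ n) / (poch q x n.+1 * poch q y n.+1).
  by rewrite -[LHS](@fracE _ _ (1 - y * q ^+ n)) ?unitrM ?ux // [poch q y n.+1]pochS !mulrA.
have -> : q ^+ (n ^ 2) / (poch q x n * poch q y n) =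
    q ^+ (n ^ 2) * ((1 - x * q ^+ n) * (1 - y * q ^+ n)) / (poch q x n.+1 * poch q y n.+1).
  rewrite -[LHS](@fracE _ _ ((1 - x * q ^+ n) * (1 - y * q ^+ n))) ?unitrM ?ux' ?uxn //.
  by rewrite ![poch _ _ n.+1]pochS mulrACA.
ring.
Qed.

(** Here [t] stands for q/u^2. [ellipH] truncates H(u), and [thetaH] truncates j(u;q) j(-q u^2;q^2)
    without its factors (q;q)_oo and (q^2;q^2)_oo. *)
Definition ellipH q u t n :=
  1 + u * gser q u (u * t) n +
  q * u * gser (q ^+ 4) (- (q * u ^+ 2)) (- (q ^+ 2 * t)) n -
  t * gser (q ^+ 4) (- (q ^+ 3 * u ^+ 2)) (- t) n.

Definition thetaH q u t n :=
  poch q u n * poch q (u * t) n *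
  (poch (q ^+ 4) (- (q * u ^+ 2)) n.+1 * poch (q ^+ 4) (- (q ^+ 2 * t)) n) *
  (poch (q ^+ 4) (- (q ^+ 3 * u ^+ 2)) n * poch (q ^+ 4) (- t) n.+1).

Lemma ellip_ellipH q u t n : u ^+ 2 * t = q ->
  (forall k, poch q u k \is a GRing.unit) ->
  (forall k, poch q (u * t) k \is a GRing.unit) ->
  (forall k, poch (q ^+ 4) (- (q * u ^+ 2)) k \is a GRing.unit) ->
  (forall k, poch (q ^+ 4) (- (q ^+ 2 * t)) k \is a GRing.unit) ->
  (forall k, poch (q ^+ 4) (- (q ^+ 3 * u ^+ 2)) k \is a GRing.unit) ->
  (forall k, poch (q ^+ 4) (- t) k \is a GRing.unit) ->
  ellip n q u = u ^+ (5 * n + 4) * (thetaH q u t n * ellipH q u t n).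
Proof.
move=> uut u1 u2 u3 u4 u5 u6.
have eu4 i : q ^+ (4 * i + 1) * u ^+ 2 = q * u ^+ 2 * q ^+ 4 ^+ i.
  by rewrite exprD exprM; ring.
have el1 i : u ^+ 2 + q ^+ (4 * i + 1) = u ^+ 2 * (1 - - t * q ^+ 4 ^+ i).
  by rewrite exprD exprM expr1 -[in X in _ + X](uut) -uut; ring.
have uE : u * (u * t) = q by rewrite -uut; ring.
have lE : lerch q u q u n = u ^+ n * (poch q u n * poch q (u * t) n * gser q u (u * t) n).
  by rewrite -lerch_gser -?lerchZ ?uE ?mulr1 // => k _; rewrite unitrM u1 u2.
have l1E : lerch1 n q u = u ^+ (2 * n) * (poch (q ^+ 4) (- (q * u ^+ 2)) n.+1 *
    poch (q ^+ 4) (- (q ^+ 2 * t)) n *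
    gser (q ^+ 4) (- (q * u ^+ 2)) (- (q ^+ 2 * t)) n).
  rewrite /lerch1.
  have -> : - q ^+ 3 = u ^+ 2 * - (q ^+ 2 * t) by rewrite -uut; ring.
  rewrite -[X in lerch _ _ _ X _](mulr1) lerchZ exprM lerch_gser; last
      by move=> k _; rewrite unitrM u3 u4.
  by rewrite pochS eu4; ring.
have l3E : lerch3 n q u = u ^+ (2 * n + 2) * (poch (q ^+ 4) (- (q ^+ 3 * u ^+ 2)) n *
    poch (q ^+ 4) (- t) n.+1 *
    gser (q ^+ 4) (- (q ^+ 3 * u ^+ 2)) (- t) n).
  rewrite /lerch3 el1 exprD exprM.
  have -> : lerch (q ^+ 4) (- (q ^+ 3 * u ^+ 2)) (- q) (u ^+ 2) n =
    (u ^+ 2) ^+ n * lerch (q ^+ 4) (- (q ^+ 3 * u ^+ 2)) (- t) 1 n.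
    by rewrite -lerchZ mulr1; congr (lerch _ _ _ _ _); rewrite -uut; ring.
  rewrite lerch_gser; last by move=> k _; rewrite unitrM u5 u6.
  by rewrite [poch _ _ n.+1]pochS; ring.
rewrite /ellip l1E l3E lE (jprod_diag _ uut) (theta1_poch _ uut) (theta3_poch _ uut) /thetaH
    /ellipH.
have -> : u ^+ (5 * n + 4) = u ^+ 4 * u ^+ n * (u ^+ (2 * n)) ^+ 2.
  by rewrite -exprM -!exprD; congr (_ ^+ _); lia.
rewrite [u ^+ (2 * n + 2)]exprD.
move: (gser _ _ _ _) (gser _ _ _ _) (gser _ _ _ _) => A B D.
do 6! move: (poch _ _ _) => ?.
move: (u ^+ (2 * n)) (u ^+ n) => s r; rewrite -uut; ring.
Qed.

End LerchSeries.

Section EqmMore.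
Variable R : comNzRingType.
Implicit Types f g h : pser R.

Lemma eqm_eqr N f g : f = g -> eqm N f g.
Proof. by move=> ->. Qed.

Lemma eqm_add0 N f g : eqm N g 0 -> eqm N (f + g) f.
Proof. by move=> g0; rewrite -[X in eqm _ _ X]addr0; apply: eqmD. Qed.

Lemma eqm_mul1 N f g : eqm N g 1 -> eqm N (f * g) f.
Proof. by move=> g1; rewrite -[X in eqm _ _ X]mulr1; apply: eqmM. Qed.

Lemma eqm_prod1 N I (r : seq I) (P : pred I) (F : I -> pser R) :
  (forall i, P i -> eqm N (F i) 1) -> eqm N (\prod_(i <- r | P i) F i) 1.
Proof.
move=> F1; elim/big_rec: _ => // i x Pi x1.
by rewrite -[1](mulr1 1); apply: eqmM => //; apply: F1.
Qed.

Lemma eqm_1sub N f M : (N <= M)%N -> eqm N (1 - qX R ^+ M * f) 1.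
Proof. by move=> leNM; rewrite -[X in eqm _ _ X]subr0; apply: eqmB => //; apply: eqmXn. Qed.

Variable e : nat.
Hypothesis e_gt0 : (0 < e)%N.
Local Notation q := (qX R ^+ e).

Lemma eqm_qn N n f : (N <= n)%N -> eqm N (q ^+ n * f) 0.
Proof. by move=> leNn; rewrite -exprM; apply: eqmXn; nia. Qed.

Lemma eqm_1subqn N n f : (N <= n)%N -> eqm N (1 - q ^+ n * f) 1.
Proof. by move=> leNn; rewrite -exprM; apply: eqm_1sub; nia. Qed.

Lemma eqm_poch N f L M : (N <= L)%N -> (L <= M)%N -> eqm N (poch q f M) (poch q f L).
Proof.
move=> leNL; elim: M => [|M IH]; first by rewrite leqn0 => /eqP ->.
rewrite leq_eqVlt => /predU1P[-> //|ltLM]; rewrite pochS.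
apply: (@eqm_trans _ _ (poch q f M)); last exact: IH.
by apply: eqm_mul1; rewrite mulrC; apply: eqm_1subqn; lia.
Qed.

(** * Durfee rectangles and the residue of g *)

Section Durfee.
Variables N L : nat.
Hypothesis leNL : (N <= L)%N.

(** [P m] truncates (q^m;q)_oo, so [W k] is (q;q)_oo^2 times the Durfee rectangle sum of q^(n^2+kn)
    / ((q;q)_n (q;q)_(n+k)), which equals 1/(q;q)_oo for every k. *)
Let P m : pser R := \prod_(m <= i < L) (1 - q ^+ i).
Let A k n : pser R := q ^+ (n ^ 2 + k * n) * P n.+1 * P (n + k).+1.
Let W k := \sum_(n < L) A k n.

Let P_rec m : eqm N (P m) ((1 - q ^+ m) * P m.+1).
Proof.
have [ltmL|leLm] := ltnP m L; first by rewrite /P big_ltn.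
rewrite /P !big_geq ?(leqW leLm) // mulr1; apply: eqm_sym.
by rewrite -[q ^+ m]mulr1; apply: eqm_1subqn; apply: leq_trans leLm.
Qed.

(* [W k - W k.+1 = - q^(k+1) (W k.+1 - W k.+2)], so these differences vanish to all orders. *)
Let W_rec k : eqm N (W k - W k.+1) (- (q ^+ k.+1 * (W k.+1 - W k.+2))).
Proof.
case: (posnP N) => [->|N_gt0]; first by [].
have L_gt0 : (0 < L)%N := leq_trans N_gt0 leNL.
(* The bracket (1 - q^(n+k+1)) - q^n is regrouped as (1 - q^n) - q^(n+k+1). Its first part gives
   [F], which vanishes at n = 0 and can therefore be shifted by one. *)
pose F n : pser R := q ^+ (n ^ 2 + k * n) * P n * P (n + k).+2.
pose G n : pser R := q ^+ (n ^ 2 + k * n + n + k.+1) * P n.+1 * P (n + k).+2.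
have WFG : eqm N (W k - W k.+1) (\sum_(n < L) F n - \sum_(n < L) G n).
  rewrite -!sumrB; apply: eqm_sum => n _; rewrite /A /F /G.
  have -> : q ^+ (n ^ 2 + k.+1 * n) = q ^+ (n ^ 2 + k * n) * q ^+ n.
    by rewrite -exprD; congr (_ ^+ _); lia.
  have -> : q ^+ (n ^ 2 + k * n + n + k.+1) = q ^+ (n ^ 2 + k * n) * q ^+ (n + k).+1.
    by rewrite -exprD; congr (_ ^+ _); lia.
  rewrite addnS; move: (q ^+ (n ^ 2 + _)) => s.
  apply: (@eqm_trans _ _ (s * P n.+1 * ((1 - q ^+ (n + k).+1) * P (n + k).+2)
                          - s * q ^+ n * P n.+1 * P (n + k).+2)).
    by apply: eqmB => //; apply: eqmMl; apply: P_rec.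
  apply: (@eqm_trans _ _ (s * ((1 - q ^+ n) * P n.+1) * P (n + k).+2
                          - s * q ^+ (n + k).+1 * P n.+1 * P (n + k).+2)).
    by apply: eqm_eqr; ring.
  by apply: eqmB => //; apply: eqmMr; apply: eqmMl; apply: eqm_sym; apply: P_rec.
apply: (eqm_trans WFG).
have FE : eqm N (\sum_(n < L) F n) (\sum_(n < L) F n.+1).
  have F0 : F 0%N = 0.
    by rewrite /F /P big_ltn // subrr !(mul0r, mulr0).
  apply: eqm_sym; rewrite -[X in eqm N X](add0r) -{1}F0.
  have -> : F 0%N + \sum_(n < L) F n.+1 = \sum_(n < L.+1) F n by rewrite big_ord_recl.
  rewrite big_ord_recr /=; apply: eqm_add0.
  by rewrite /F -mulrA; apply: eqm_qn; nia.
apply: (eqm_trans (eqmB FE (@eqm_refl R N (\sum_(n < L) G n)))).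
rewrite -sumrB mulrBr !mulr_sumr -sumrB -sumrN; apply: eqm_sum => n _.
rewrite opprB; apply: eqmB; last first.
  by apply: eqm_eqr; rewrite /G /A !mulrA -exprD [(n + k.+1)%N]addnS; congr (_ ^+ _ * _ * _); lia.
rewrite /F /A; have -> : q ^+ k.+1 * (q ^+ (n ^ 2 + k.+2 * n) * P n.+1 * P (n + k.+2).+1) =
   q ^+ (n.+1 ^ 2 + k * n.+1) * P n.+1 * P (n.+1 + k).+2.
  by rewrite !mulrA -exprD; congr (_ ^+ _ * _ * P _); lia.
by [].
Qed.

Let W_const k : eqm N (W k - W k.+1) 0.
Proof.
suff H j : (j <= N)%N -> forall m, eqm j (W m - W m.+1) 0 by apply: H.
elim: j => [|j IH] lejN m; first by [].
apply: (eqm_trans (eqm_le lejN (W_rec m))).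
rewrite -[0]oppr0; apply: eqmN.
have /eqmP[c] := IH (ltnW lejN) m.+1; rewrite subr0 => ->.
have -> : q ^+ m.+1 * (qX R ^+ j * c) = qX R ^+ (e * m.+1 + j) * c.
  by rewrite -exprM mulrA -exprD.
by apply: eqmXn; nia.
Qed.

(** At a = 1 and c = q the sum is [W 1]. Since [W] is constant in k, it may be replaced by [W N],
    where only the term n = 0 survives modulo q^N. *)
Lemma eqm_lerch1 : eqm N (lerch q 1 q 1 L) (poch q q L).
Proof.
case: (posnP N) => [->|N_gt0]; first by [].
have L_gt0 : (0 < L)%N := leq_trans N_gt0 leNL.
have P1 : eqm N (P 1) (poch q q L).
  have -> : poch q q L = P 1 * (1 - q ^+ L).
    rewrite /P -(big_nat_recr _ _ (fun i => 1 - q ^+ i)) //= big_add1 /= big_mkord.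
    by apply: eq_bigr => i _; rewrite -exprS.
  by apply: eqm_sym; apply: eqm_mul1; rewrite -[q ^+ L]mulr1; apply: eqm_1subqn.
apply: eqm_trans P1.
have WN : eqm N (W N) (P 1).
  rewrite /W -(prednK L_gt0) big_ord_recl /=; apply: (@eqm_trans _ _ (A N 0)).
    apply: eqm_add0; apply: (@eqm_trans _ _ (\sum_(i < L.-1) 0)); last by rewrite big1.
    by apply: eqm_sum => n _; rewrite /A /bump /= -mulrA; apply: eqm_qn; nia.
  rewrite /A muln0 expr0 mul1r; apply: eqm_mul1; rewrite /P big_nat.
  apply: eqm_prod1 => i /andP[lti _].
  by rewrite -[q ^+ i]mulr1; apply: eqm_1subqn; lia.
have W1 j : eqm N (W 1) (W (1 + j)).
  elim: j => [|j IH]; first by [].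
  apply: (eqm_trans IH); rewrite addnS -[W _](subrK (W (1 + j).+1)).
  by rewrite addrC; apply: eqm_add0; apply: W_const.
apply: eqm_trans WN; rewrite -[in W N](prednK N_gt0); apply: eqm_trans (W1 N.-1).
rewrite lerch_prod; apply: eqm_sum => n _.
rewrite expr1n mul1r /A -mulrA (_ : n ^ 2 + 1 * n = n * n.+1)%N; last by lia.
apply: eqmMl; rewrite big_split /= (eq_bigr (fun i => 1 - q ^+ i)); last first.
  by move=> i _; rewrite mul1r.
apply: eqmMl; rewrite (eq_bigr (fun i => 1 - q ^+ i.+1)); last first.
  by move=> i _; rewrite exprS.
rewrite /P addn1; have [ltnL|leLn] := ltnP n.+1 L; last by rewrite !big_geq // leqW.
have -> : \prod_(n.+1 <= i < L) (1 - q ^+ i.+1) = P n.+2 * (1 - q ^+ L).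
  by rewrite /P -(big_nat_recr _ _ (fun i => 1 - q ^+ i)) //= [RHS]big_add1.
apply: eqm_mul1.
by rewrite -[q ^+ L]mulr1; apply: eqm_1subqn.
Qed.

End Durfee.

(* At [u = 1] only the residue of [g] at its pole survives. *)
Lemma ellip_at1 N L : (N <= L)%N ->
  eqm N (ellip L.+1 q 1) (poch q q L.+1 * theta1 L.+1 q 1 * theta3 L.+1 q 1).
Proof.
move=> leNL; rewrite /ellip.
have -> : jprod q 1 q 1 L.+1 = 0 by rewrite /jprod big_ord_recl expr0 mulr1 subrr !mul0r.
rewrite !expr1n !(mulr0, mul0r) add0r subr0 addr0 mul1r.
by apply: eqmMr; apply: eqmMr; apply: eqm_lerch1; apply: leqW.
Qed.


End EqmMore.

Section EllipticIdentity.
Variable R : comUnitRingType.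
Variable e : nat.
Hypothesis e_gt0 : (0 < e)%N.
Local Notation q := (qX R ^+ e).

(** The constant of [ellip_eval] is read off at [u] and at 1. The right side is its value at 1,
    where [theta1] and [theta3] coincide. *)
Lemma elliptic_identity (u t : pser R) N L : u ^+ 2 * t = q -> GRing.lreg u ->
  (N <= L)%N ->
  (forall k, poch q u k \is a GRing.unit) ->
  (forall k, poch q (u * t) k \is a GRing.unit) ->
  (forall k, poch (q ^+ 4) (- (q * u ^+ 2)) k \is a GRing.unit) ->
  (forall k, poch (q ^+ 4) (- (q ^+ 2 * t)) k \is a GRing.unit) ->
  (forall k, poch (q ^+ 4) (- (q ^+ 3 * u ^+ 2)) k \is a GRing.unit) ->
  (forall k, poch (q ^+ 4) (- t) k \is a GRing.unit) ->
  eqm N (thetaH q u t L.+1 * ellipH q u t L.+1)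
        (poch q q L.+1 * (poch (q ^+ 4) (- q) L.+2 * poch (q ^+ 4) (- q ^+ 3) L.+1) ^+ 2).
Proof.
move=> uut ureg leNL u1 u2 u3 u4 u5 u6.
have [c ec] := ellip_eval (@qXn_lreg R e) (isT : (0 < L.+1)%N).
have [d ed] := ec u t uut;
    have [d' ed'] := ec 1 q (eq_trans (congr1 (fun x => x * q) (expr1n _ 2)) (mul1r q)).
have ellE := ellip_ellipH L.+1 uut u1 u2 u3 u4 u5 u6.
rewrite expr1n mul1r in ed'.
have th1 : theta1 L.+1 q 1 * theta3 L.+1 q 1 =
   (poch (q ^+ 4) (- q) L.+2 * poch (q ^+ 4) (- q ^+ 3) L.+1) ^+ 2.
  have up1 n : upper q 1 n 1 = poch (q ^+ 4) (- q) n.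
    by apply: eq_bigr => i _; rewrite expr1n mulr1 exprD exprM; ring.
  have up3 n : upper q 1 n 3 = poch (q ^+ 4) (- q ^+ 3) n.
    by apply: eq_bigr => i _; rewrite expr1n mulr1 exprD exprM; ring.
  have lo1 n : lower q 1 n 1 = poch (q ^+ 4) (- q) n.
    by apply: eq_bigr => i _; rewrite expr1n exprD exprM; ring.
  have lo3 n : lower q 1 n 3 = poch (q ^+ 4) (- q ^+ 3) n.
    by apply: eq_bigr => i _; rewrite expr1n exprD exprM; ring.
  by rewrite /theta1 /theta3 up1 up3 lo1 lo3; ring.
rewrite -th1 mulrA; refine (eqm_trans _ (@ellip_at1 R e e_gt0 N L leNL)).
rewrite ed'; apply: (@eqm_trans _ _ c); last first.
  by apply: eqm_sym; apply: eqm_add0; apply: eqm_qn.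
have -> : thetaH q u t L.+1 * ellipH q u t L.+1 = c + q ^+ L * d.
  by apply: (@lregX _ _ (5 * L.+1 + 4) ureg); rewrite /= -[LHS]ellE ed.
by apply: eqm_add0; apply: eqm_qn.
Qed.

End EllipticIdentity.

(** * Infinite products and the series of the statement *)

Section PochMore.
Variable C : comNzRingType.
Implicit Types q x : C.

Lemma poch_split2 q x n : poch q x (2 * n) = poch (q ^+ 2) x n * poch (q ^+ 2) (q * x) n.
Proof.
elim: n => [|n IH]; first by rewrite muln0 /poch !big_ord0 mulr1.
have -> : (2 * n.+1 = (2 * n).+2)%N by lia.
by rewrite !pochS IH -!exprM [q ^+ (2 * n).+1]exprS; ring.
Qed.

Lemma poch_split3 q x n :
  poch q x (3 * n) = poch (q ^+ 3) x n * poch (q ^+ 3) (q * x) n * poch (q ^+ 3) (q ^+ 2 * x) n.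
Proof.
elim: n => [|n IH]; first by rewrite muln0 /poch !big_ord0 !mulr1.
have -> : (3 * n.+1 = (3 * n).+3)%N by lia.
by rewrite !pochS IH -!exprM [q ^+ (3 * n).+2]exprS [q ^+ (3 * n).+1]exprS; ring.
Qed.

Lemma poch_opp q x n : poch q x n * poch q (- x) n = poch (q ^+ 2) (x ^+ 2) n.
Proof.
rewrite /poch -big_split; apply: eq_bigr => i _ /=.
by rewrite -exprM mulnC exprM; ring.
Qed.

End PochMore.

Lemma gserC (C : comUnitRingType) (q x y : C) n : gser q x y n = gser q y x n.
Proof. by apply: eq_bigr => i _; rewrite [poch q x _ * _]mulrC. Qed.

Lemma poch_coef0 (R : comNzRingType) (q x : pser R) n : x 0%N = 0 -> poch q x n 0%N = 1.
Proof.
move=> x0; elim: n => [|n IH]; first by rewrite /poch big_ord0.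
by rewrite pochS psM0 IH psD psN psM0 x0 mul0r subr0 mulr1.
Qed.

Lemma poch_unit (R : comUnitRingType) (q x : pser R) n :
  x 0%N = 0 -> poch q x n \is a GRing.unit.
Proof. by move=> x0; rewrite ps_unitE poch_coef0 ?unitr1. Qed.

Section Interface.
Notation X := (qX int).
Implicit Types f g : fps.

Lemma fps_addE f g : fps_add f g = (f : pser int) + g. Proof. by []. Qed.
Lemma fps_oppE f : fps_opp f = - (f : pser int). Proof. by []. Qed.
Lemma fps_mulE f g : fps_mul f g = (f : pser int) * g. Proof. by []. Qed.
Lemma fps_subE f g : fps_sub f g = (f : pser int) - (g : pser int). Proof. by []. Qed.

Lemma ps_natE (R : comNzRingType) c n : (c%:R : pser R) n = if n == 0%N then c%:R else 0.
Proof.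
elim: c => [|c IH]; first by rewrite !mulr0n ps0; case: ifP.
by rewrite -natr1 psD IH ps1; case: eqP => _; rewrite /= ?mulr1n ?mulr0n ?addr0 ?natr1.
Qed.

Lemma fps_constE c : fps_const c = c%:~R :> pser int.
Proof.
apply/funext => n; rewrite /fps_const; case: c => c.
  by rewrite -pmulrn ps_natE; case: ifP => // _; rewrite natz.
by rewrite NegzE mulrNz -pmulrn psN ps_natE; case: ifP => //; rewrite ?natz ?oppr0.
Qed.

Lemma fps_XE a : fps_X a = X ^+ a.
Proof. by apply/funext => n; rewrite qXn /fps_X; case: ifP. Qed.

Lemma fps_scaleE c f : fps_scale c f = c%:~R * (f : pser int).
Proof.
rewrite -fps_constE; apply/funext => n; rewrite psM big_ord_recl subn0 big1 ?addr0 // => i _.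
by rewrite /fps_const mul0r.
Qed.

Lemma qpochE c a m n : qpoch c a m n = poch (X ^+ m) (c%:~R * X ^+ a) n.
Proof.
rewrite /qpoch /poch -(big_mkord xpredT (fun i => 1 - c%:~R * X ^+ a * X ^+ m ^+ i)).
rewrite /index_iota subn0; elim: (iota 0 n) => [|i s IH] /=.
  by rewrite big_nil /fps_prod /= fps_constE.
by rewrite big_cons -IH fps_mulE fps_subE fps_scaleE fps_XE fps_constE exprD exprM mulrA.
Qed.

Lemma eqm_qpoch_inf c a m N L : (0 < m)%N -> (N <= L)%N ->
  eqm N (qpoch_inf c a m) (poch (X ^+ m) (c%:~R * X ^+ a) L).
Proof.
move=> m_gt0 leNL k ltkN; rewrite /qpoch_inf qpochE.
apply: esym; apply: (@eqm_poch _ m m_gt0 k.+1) => //.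
exact: leq_trans leNL.
Qed.

Lemma fps_invE f : f 0%N = 1 -> fps_inv f = (f : pser int)^-1.
Proof.
move=> f0.
have sz n : size (fps_inv_seq f n) = n.+1.
  by elim: n => //= n IH; rewrite size_rcons IH.
have nthE n i : (i <= n)%N -> nth 0 (fps_inv_seq f n) i = fps_inv f i.
  elim: n => [|n IH]; first by rewrite leqn0 => /eqP ->.
  rewrite leq_eqVlt => /predU1P[-> //|ltin].
  by rewrite /= nth_rcons sz ltin IH.
have fV : (f : pser int) * fps_inv f = 1.
  apply/funext => n; rewrite psM ps1; case: n => [|n].
    by rewrite big_ord1 /fps_inv /= f0.
  rewrite big_ord_recl /= subn0 f0 mul1r {1}/fps_inv /= nth_rcons sz ltnn eqxx f0.
  rewrite mulN1r addrC; apply/eqP; rewrite subr_eq0; apply/eqP.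
  apply: eq_bigr => i _; rewrite /bump /= add1n subSS nthE //; exact: leq_subr.
have uf : (f : pser int) \is a GRing.unit by rewrite ps_unitE f0.
by rewrite -[RHS]mulr1 -fV mulKr.
Qed.

(** The defining series is 1 + x g(x;q^m) with x = c q^b; as c is its own inverse, q^m/x = c
    q^(m-b). *)
Lemma gsum_eqm c b m N L : c * c = 1 -> (0 < b)%N -> (b < m)%N -> (N <= L)%N ->
  eqm N (gsum c b m)
    (1 + c%:~R * X ^+ b * gser (X ^+ m) (c%:~R * X ^+ b) (c%:~R * X ^+ (m - b)) L).
Proof.
move=> cc b_gt0 ltbm leNL.
set x := c%:~R * X ^+ b; set y := c%:~R * X ^+ (m - b).
have xyq : x * y = X ^+ m by rewrite /x /y mulrACA -intrM cc mul1r -exprD subnKC // ltnW.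
have x0 : x 0%N = 0 by rewrite /x psM0 qXn ltn_eqF // mulr0.
have y0 : y 0%N = 0 by rewrite /y psM0 qXn ltn_eqF ?mulr0 // subn_gt0.
have m_gt0 : (0 < m)%N := ltn_trans b_gt0 ltbm.
have le_msq k : (k <= m * k ^ 2)%N.
  case: k => // k; apply: (@leq_trans (k.+1 ^ 2)%N); last exact: leq_pmull.
  by rewrite -mulnn leq_pmulr.
have termE n : fps_div (fps_X (m * n ^ 2)) (fps_mul (qpoch c b m n.+1) (qpoch c (m - b) m n))
   = (X ^+ m) ^+ (n ^ 2) / (poch (X ^+ m) x n.+1 * poch (X ^+ m) y n).
  rewrite /fps_div !qpochE !fps_mulE fps_invE; first by rewrite fps_XE exprM.
  by rewrite psM0 !poch_coef0.
have gE : eqm N (gsum c b m)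
    (\sum_(n < L) (X ^+ m) ^+ (n ^ 2) / (poch (X ^+ m) x n.+1 * poch (X ^+ m) y n)).
  move=> k ltkN; rewrite /gsum /fps_sum_inf.
  rewrite ps_sum -(subnKC (leq_trans ltkN leNL)) big_split_ord /= [X in _ = _ + X]big1 ?addr0.
    by apply: eq_bigr => n _; rewrite termE.
  by move=> n _; rewrite -exprM qXnM ifT //; apply: leq_trans (le_msq _); rewrite leq_addr.
refine (eqm_trans gE _).
have unitP k : (k <= L)%N -> poch (X ^+ m) x k * poch (X ^+ m) y k \is a GRing.unit.
  by move=> _; rewrite unitrM !poch_unit.
have e := @rank_gser (pser int) (X ^+ m) x y L xyq unitP.
rewrite e.
rewrite -[X in eqm _ _ X]subr0; apply: eqmB => //; rewrite -exprM.
by apply: eqmXn; apply: leq_trans (le_msq _).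
Qed.


Notation Q c a m := (qpoch_inf c a m : pser int).

Lemma eqm_poch_inf a m N L : (0 < m)%N -> (N <= L)%N ->
  eqm N (poch (X ^+ m) (X ^+ a) L) (Q 1 a m).
Proof. by move=> m_gt0 leNL; have := eqm_sym (eqm_qpoch_inf 1 a m_gt0 leNL); rewrite mul1r. Qed.

Lemma eqm_poch_infN a m N L : (0 < m)%N -> (N <= L)%N ->
  eqm N (poch (X ^+ m) (- X ^+ a) L) (Q (-1) a m).
Proof.
move=> m_gt0 leNL; have := eqm_sym (eqm_qpoch_inf (-1) a m_gt0 leNL).
by rewrite mulrNz mulN1r.
Qed.

Lemma qpoch_inf_split2 c a m : (0 < m)%N ->
  Q c a m = Q c a (2 * m) * Q c (a + m) (2 * m).
Proof.
move=> m_gt0; apply: eqm_eq => N.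
have m2_gt0 : (0 < 2 * m)%N by lia.
apply: (@eqm_trans _ _ (poch (X ^+ m) (c%:~R * X ^+ a) (2 * N))).
  by apply: eqm_qpoch_inf => //; lia.
rewrite poch_split2 -exprM mulnC mulrCA -exprD [(m + a)%N]addnC.
by apply: eqmM; apply: eqm_sym; apply: eqm_qpoch_inf.
Qed.

Lemma qpoch_inf_split3 c a m : (0 < m)%N ->
  Q c a m = Q c a (3 * m) * Q c (a + m) (3 * m) * Q c (a + 2 * m) (3 * m).
Proof.
move=> m_gt0; apply: eqm_eq => N.
have m3_gt0 : (0 < 3 * m)%N by lia.
apply: (@eqm_trans _ _ (poch (X ^+ m) (c%:~R * X ^+ a) (3 * N))).
  by apply: eqm_qpoch_inf => //; lia.
rewrite poch_split3 -!exprM mulnC mulrCA -exprD [(m + a)%N]addnC.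
rewrite mulrCA -exprD [(m * 2 + a)%N]addnC [(m * 2)%N]mulnC.
by apply: eqmM; [apply: eqmM|]; apply: eqm_sym; apply: eqm_qpoch_inf.
Qed.

Lemma qpoch_inf_opp a m : (0 < m)%N ->
  Q 1 a m * Q (-1) a m = Q 1 (2 * a) (2 * m).
Proof.
move=> m_gt0; apply: eqm_eq => N.
have m2_gt0 : (0 < 2 * m)%N by lia.
apply: (@eqm_trans _ _ (poch (X ^+ m) (X ^+ a) N * poch (X ^+ m) (- X ^+ a) N)).
  apply: eqmM; apply: (eqm_trans (eqm_qpoch_inf _ _ m_gt0 (leqnn N))).
    by rewrite mul1r.
  by rewrite mulrNz mulN1r.
rewrite poch_opp -!exprM mulnC [(a * 2)%N]mulnC -[X ^+ (2 * a)]mul1r.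
by apply: eqm_sym; apply: eqm_qpoch_inf.
Qed.

Lemma qpoch_inf_coef0 c a m : (0 < a)%N -> Q c a m 0%N = 1.
Proof.
move=> a_gt0; rewrite /qpoch_inf qpochE poch_coef0 //.
by rewrite psM0 qXn ltn_eqF // mulr0.
Qed.

Lemma qpoch_inf_lreg c a m : (0 < a)%N -> GRing.lreg (Q c a m).
Proof.
by move=> a_gt0; apply: mulrI; rewrite ps_unitE qpoch_inf_coef0 ?unitr1.
Qed.

(* Stated with opaque letters: unification must not compare powers of [X] by unfolding. *)
Let gsum_combine N (Y x2 x4 x6 S1 S2 S6 g1 g2 g6 : pser int) :
  eqm N S1 (1 + Y * g1) -> eqm N S6 (1 + - x6 * g6) -> eqm N S2 (1 + - x2 * g2) ->
  Y * (x4 * Y) = x6 ->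
  eqm N (Y * S1 - S6 + 1 + Y * S2 - Y) (Y * (1 + Y * g1 + x4 * Y * g6 - x2 * g2)).
Proof.
move=> s1 s6 s2 e; rewrite -e in s6.
refine (eqm_trans (eqmB (eqmD (eqmD (eqmB (eqmMl Y s1) s6) (@eqm_refl _ N 1))
                              (eqmMl Y s2)) (@eqm_refl _ N Y)) _).
by apply: eqm_eqr; ring.
Qed.

(* The elliptic identity at u = q, with q replaced by q^4. *)
Lemma gsum_relation :
  Q 1 1 4 * Q 1 3 4 * (Q (-1) 6 16 * Q (-1) 10 16) * (Q (-1) 14 16 * Q (-1) 2 16) *
    (X * (gsum 1 1 4 : pser int) - (gsum (-1) 6 16 : pser int) + 1
     + X * (gsum (-1) 2 16 : pser int) - X) =
  X * (Q 1 4 4 * (Q (-1) 4 16 * Q (-1) 12 16) ^+ 2).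
Proof.
apply: eqm_eq => N.
have x1 k : (0 < k)%N -> (X ^+ k : pser int) 0%N = 0 by move=> ?; rewrite qXn ltn_eqF.
have x2 k : (0 < k)%N -> (- X ^+ k : pser int) 0%N = 0 by move=> ?; rewrite psN x1 ?oppr0.
have XM a b c : (a * b = c)%N -> X ^+ a ^+ b = X ^+ c by move=> <-; rewrite exprM.
have XD a b c : (a + b = c)%N -> X ^+ a * X ^+ b = X ^+ c by move=> <-; rewrite exprD.
have q16 := XM 4%N 4%N 16%N erefl; have q8 := XM 4%N 2%N 8%N erefl;
    have q12 := XM 4%N 3%N 12%N erefl.
have uE1 : X * X ^+ 2 = X ^+ 3 by rewrite -exprS.
have uE2 := XD 4%N 2%N 6%N erefl; have uE3 := XD 8%N 2%N 10%N erefl;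
    have uE4 := XD 12%N 2%N 14%N erefl.
have := @elliptic_identity int 4 isT X (X ^+ 2) N N.
rewrite /thetaH /ellipH q16 q8 q12 uE1 uE2 uE3 uE4 (XD 2%N 2%N 4%N erefl).
have Xreg : GRing.lreg X by have := @qXn_lreg int 1; rewrite expr1.
move=> /(_ erefl Xreg (leqnn N)).
have pu a k : (0 < a)%N -> poch (X ^+ 4) (X ^+ a) k \is a GRing.unit.
  by move=> a_gt0; apply: poch_unit; apply: x1.
have pu' a k : (0 < a)%N -> poch (X ^+ 16) (- X ^+ a) k \is a GRing.unit.
  by move=> a_gt0; apply: poch_unit; apply: x2.
have pu1 k : poch (X ^+ 4) X k \is a GRing.unit by apply: poch_unit.
move=> /(_ pu1 (fun k => pu 3%N k isT) (fun k => pu' 6%N k isT)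
  (fun k => pu' 10%N k isT) (fun k => pu' 14%N k isT) (fun k => pu' 2%N k isT)) key.
have pQ a m L := @eqm_poch_inf a m N L; have pQ' a m L := @eqm_poch_infN a m N L.
have s1 := @gsum_eqm 1 1 4 N N.+1 erefl isT isT (leqnSn N).
have s6 := @gsum_eqm (-1) 6 16 N N.+1 erefl isT isT (leqnSn N).
have s2 := @gsum_eqm (-1) 2 16 N N.+1 erefl isT isT (leqnSn N).
rewrite !mul1r expr1 in s1; rewrite !mulrNz !mulN1r in s6; rewrite !mulrNz !mulN1r in s2.
have leN1 : (N <= N.+1)%N := leqnSn N.
have leN2 : (N <= N.+2)%N := leqW leN1.
(* The factor [X] turns the term X^5 g(-X^6;X^16) of H into X^6 g(-X^6;X^16), the form in which
   [gsum] contains it. *)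
refine (eqm_trans _ (eqm_trans (eqmMl X key) _)); last first.
  apply: eqmMl; apply: eqmM; first exact: pQ.
  have k := eqmM (@pQ' 4 16 N.+2 isT leN2) (@pQ' 12 16 N.+1 isT leN1).
  by rewrite !expr2; exact: (eqmM k k).
rewrite [X in eqm _ _ X]mulrCA; apply: eqmM.
  have p1 : eqm N (Q 1 1 4) (poch (X ^+ 4) X N.+1).
    by have := @pQ 1 4 N.+1 isT leN1; rewrite expr1 => /eqm_sym.
  apply: eqm_sym; apply: eqmM; [apply: eqmM; [apply: eqmM|]|].
  - exact: eqm_sym p1.
  - exact: pQ.
  - by apply: eqmM; apply: pQ'.
  - by apply: eqmM; apply: pQ'.
(* The identity produces g(-X^14;X^16), which by symmetry is g(-X^2;X^16). *)
rewrite gserC in s2; apply: gsum_combine s1 s6 s2 _.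
by rewrite -exprSr -exprS.
Qed.

End Interface.

(** * Dissection of theta functions *)

Definition ps_coef0 (R : comNzRingType) (f : pser R) : R := f 0%N.
Section Coef0.
Variable R : comNzRingType.
Lemma ps_coef0_is_zmod_morphism : zmod_morphism (@ps_coef0 R).
Proof. by []. Qed.
Lemma ps_coef0_is_monoid_morphism : monoid_morphism (@ps_coef0 R).
Proof. by split => // f g; apply: psM0. Qed.
HB.instance Definition _ := GRing.isZmodMorphism.Build (pser R) R (@ps_coef0 R)
  ps_coef0_is_zmod_morphism.
HB.instance Definition _ := GRing.isMonoidMorphism.Build (pser R) R (@ps_coef0 R)
  ps_coef0_is_monoid_morphism.

End Coef0.

Section Dissection.
Variables (R : comUnitRingType) (e : nat).
Hypothesis e_gt0 : (0 < e)%N.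
Local Notation q := (qX R ^+ e).
Local Notation PS := {poly pser R}.

Section Level.
Variable n : nat.
Hypothesis n_gt0 : (0 < n)%N.
(** Up to Euler products, [J] and [F] truncate x^D j(x;q) and x^D (j(-q x^2;q^4) - x j(-q^3
    x^2;q^4)); the length [D] of [J] gives both the same power of x. *)
Let D := (2 * n + 2)%N.
Let J : PS := jprod q%:P 'X q%:P 'X D.
Let F : PS := 'X ^+ 2 * theta1 n q%:P 'X - 'X * theta3 n q%:P 'X.

Definition dissect q' (u : pser R) := u ^+ 2 * theta1 n q' u - u * theta3 n q' u.

Lemma horner_jprod u : J.[u] = jprod q u q u D.
Proof.
by rewrite -[J.[u]]/(horner_eval u J) rmorph_jprod /= /horner_eval hornerC hornerX.
Qed.

Lemma horner_dissect u : F.[u] = dissect q u.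
Proof.
have t1 : (theta1 n q%:P ('X : PS)).[u] = theta1 n q u.
  by rewrite -[LHS]/(horner_eval u _) rmorph_theta1 /= /horner_eval hornerC hornerX.
have t3 : (theta3 n q%:P ('X : PS)).[u] = theta3 n q u.
  by rewrite -[LHS]/(horner_eval u _) rmorph_theta3 /= /horner_eval hornerC hornerX.
rewrite /F /dissect -t1 -t3; move: (theta1 _ _ _) (theta3 _ _ _) => a b.
by rewrite !hornerE.
Qed.

(** At q = 0 the product is (1 - x) x^D. *)
Lemma jprod_center : J`_D \is a GRing.unit.
Proof.
rewrite ps_unitE -[J`_D 0%N]/(ps_coef0 (J`_D)) -coef_map rmorph_jprod.
rewrite /= !map_polyC map_polyX /= {1 2}/ps_coef0 qXn ltn_eqF // mulr0n.
rewrite /jprod /D addn2 big_ord_recl /= mul0r subr0 expr0 mulr1.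
rewrite (eq_bigr (fun=> 'X)); last
    by move=> i _; rewrite /bump /= expr0n mulr0 mul0r !subr0 mul1r.
rewrite prodr_const card_ord -mulrA -exprS mulrBl mul1r -exprS coefB !coefXn eqxx.
by rewrite ltn_eqF // subr0 unitr1.
Qed.

(** Cross-multiplying [J] and [F] by their central coefficients and subtracting leaves a solution of
    the same shift equation with zero central coefficient, to which [theta_zero] applies. *)
Lemma dissect_eval : exists c, forall u v, u * v = q ->
  exists d, jprod q u q u D * c = dissect q u * J`_D + u ^+ D * (q ^+ D * d).
Proof.
exists F`_D => u v uvq.
pose J' : PS := jshift D q%:P 'X.
pose F' : PS := 'X ^+ 2 * theta1s n q%:P 'X - 'X * theta1 n q%:P 'X.
have JqX : J \Po (q%:P * 'X) = q%:P ^+ D * J'.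
  by rewrite -[LHS]/(comp_poly (q%:P * 'X) J) rmorph_jprod /= comp_polyC comp_polyX jprod_qx.
have FqX : F \Po (q%:P * 'X) = q%:P ^+ D * F'.
  have e1 := rmorph_theta1 (comp_poly (q%:P * 'X)) n q%:P ('X : PS).
  have e3 := rmorph_theta3 (comp_poly (q%:P * 'X)) n q%:P ('X : PS).
  rewrite /= comp_polyC comp_polyX theta1_qx in e1.
  rewrite /= comp_polyC comp_polyX theta3_qx in e3.
  move: e1 e3; rewrite /F /F' /D;
      move: (theta1 _ _ _) (theta3 _ _ _) (theta1s _ _ _) => a b c ea eb.
  rewrite comp_polyB !comp_polyM ea eb comp_polyX !exprD; ring.
have cgF : cg (q%:P ^+ D) ('X * F') (- F).
  have [c] := theta1s_congr n q%:P ('X : PS); rewrite /F /F'.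
  rewrite (_ : 4 * n + 1 = D + (2 * n - 1))%N ?exprD; last by rewrite /D; lia.
  move: (theta1 _ _ _) (theta3 _ _ _) (theta1s _ _ _) => a b d ec.
  exists ('X * (q%:P ^+ (2 * n - 1) * c)).
  have -> : 'X * ('X ^+ 2 * d - 'X * a) = 'X * ('X ^+ 2 * d) - 'X ^+ 2 * a by ring.
  by rewrite ec; ring.
have [|||d] := @theta_zero _ q u v D D (J * (F`_D)%:P - F * (J`_D)%:P)
   (J' * (F`_D)%:P - F' * (J`_D)%:P) (@qXn_lreg R e) uvq.
- by rewrite comp_polyB !comp_polyM !comp_polyC JqX FqX; ring.
- have [c ec] := jshift_congr D q%:P ('X : PS); have [d ed] := cgF.
  exists (c * (F`_D)%:P - d * (J`_D)%:P).
  have -> : 'X * (J' * (F`_D)%:P - F' * (J`_D)%:P) =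
      'X * J' * (F`_D)%:P - 'X * F' * (J`_D)%:P by ring.
  by rewrite ec ed -/J; ring.
- by rewrite coefB !coefMC mulrC subrr.
rewrite hornerD hornerN !hornerM !hornerC horner_jprod horner_dissect => ed.
exists d; move: ed; set a := _ * _; set b := _ * J`_D => ed.
by rewrite -ed addrC subrK.
Qed.

End Level.

(* The shift x -> qx fixes the functions up to a constant factor, which is computed at x = -1. *)
Lemma theta_dissection u t N : u ^+ 2 * t = q -> GRing.lreg u ->
  eqm N (poch q u (2 * N.+1 + 2) * poch q (u * t) (2 * N.+1 + 2) *
         (poch (q ^+ 4) (- q) N.+2 * poch (q ^+ 4) (- q ^+ 3) N.+1) *+ 2)
        ((poch (q ^+ 4) (- (q * u ^+ 2)) N.+2 * poch (q ^+ 4) (- (q ^+ 2 * t)) N.+1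
          - u * (poch (q ^+ 4) (- (q ^+ 3 * u ^+ 2)) N.+1 * poch (q ^+ 4) (- t) N.+2)) *
         (poch q (-1) (2 * N.+1 + 2) * poch q (- q) (2 * N.+1 + 2))).
Proof.
move=> uut ureg; set n := N.+1; set D := (2 * n + 2)%N.
have [c ec] := @dissect_eval n isT.
have evalE v s : v ^+ 2 * s = q -> GRing.lreg v -> exists d,
    poch q v D * poch q (v * s) D * c =
    (poch (q ^+ 4) (- (q * v ^+ 2)) n.+1 * poch (q ^+ 4) (- (q ^+ 2 * s)) n -
     v * (poch (q ^+ 4) (- (q ^+ 3 * v ^+ 2)) n * poch (q ^+ 4) (- s) n.+1)) *
    (jprod q%:P 'X q%:P 'X D)`_D + q ^+ D * d.
  move=> vvs vreg; have [d ed] := ec v (v * s) (eq_trans (mulrA v v s) vvs).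
  exists d; apply: (@lregX _ _ D vreg); rewrite /= mulrDr -/D [LHS]mulrA -(jprod_diag _ vvs) ed.
  congr (_ + _); rewrite /dissect (theta1_poch _ vvs) (theta3_poch _ vvs) [RHS]mulrA.
  move: (poch _ _ _) (poch _ _ _) (poch _ _ _) (poch _ _ _) (_`_D) => p1 p2 p3 p4 z.
  by rewrite /D !exprD; ring.
(* At x = -1 the two halves of the dissection are equal and add up, whence the factor 2. *)
have N2 : (-1) ^+ 2 * q = q by rewrite expr2; ring.
have Nreg : GRing.lreg (-1 : pser R) by move=> f g /=; rewrite !mulN1r => /oppr_inj.
have [d ed] := evalE u t uut ureg; have [d' ed'] := evalE _ _ N2 Nreg.
move: ed ed' (jprod_center n); rewrite -/D.
have -> : - (q * (-1) ^+ 2) = - q by ring.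
have -> : - (q ^+ 3 * (-1) ^+ 2) = - q ^+ 3 by ring.
have -> : - (q ^+ 2 * q) = - q ^+ 3 by ring.
rewrite mulN1r; move: (_`_D) => z.
set A := poch q u D * poch q (u * t) D; set B := poch q (-1) D * poch q (- q) D.
set k1 := poch (q ^+ 4) (- q) _; set k3 := poch (q ^+ 4) (- q ^+ 3) _.
set K := poch (q ^+ 4) (- (q * u ^+ 2)) _ * _ - u * (_ * _); clearbody A B K k1 k3.
move=> ed ed' uz; apply/eqmP; rewrite -exprM in ed ed'.
have NeD : (N <= e * D)%N by rewrite /D /n; nia.
(* Eliminating [c] between the values at [u] and -1 leaves only the two error terms, divided by the
   unit [z]. *)
exists (qX R ^+ (e * D - N) * (z^-1 * (d * B - d' * A))).
rewrite [RHS]mulrA -exprD subnKC //; apply: (mulrI uz);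
    rewrite [RHS]mulrCA (mulrA z z^-1) mulrV // mul1r.
have -> : z * (A * (k1 * k3) *+ 2 - K * B) =
    A * ((k1 * k3 - -1 * (k3 * k1)) * z) - K * z * B by ring.
have -> : (k1 * k3 - -1 * (k3 * k1)) * z = B * c - qX R ^+ (e * D) * d' by rewrite ed' addrK.
have -> : K * z = A * c - qX R ^+ (e * D) * d by rewrite ed addrK.
ring.
Qed.

End Dissection.

(** * Product identities for the theta quotients *)

Section ThetaIdentities.
Notation X := (qX int).
Notation Q c a m := (qpoch_inf c a m : pser int).

Lemma pser_mulr2n_inj : injective (fun f : pser int => f *+ 2).
Proof.
move=> f g /= efg; apply/funext => n; have := congr1 (fun h : pser int => h n) efg.
rewrite !mulr2n !psD; lia.
Qed.

Lemma theta_norm e N D : (0 < e)%N -> (N < D)%N ->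
  eqm N (poch (X ^+ e) (-1) D * poch (X ^+ e) (- X ^+ e) D) (Q (-1) e e ^+ 2 *+ 2).
Proof.
case: D => // D e_gt0 leND; rewrite poch_recl mulrN1.
have h1 := @eqm_poch_infN e e N D e_gt0 leND.
have h2 := @eqm_poch_infN e e N D.+1 e_gt0 (leqW leND).
have -> : 1 - -1 = 2 :> pser int by ring.
move: h1 h2; move: (poch _ _ D) (poch _ _ D.+1) (Q _ _ _) => a b c h1 h2.
have -> : 2 * a * b = a * b *+ 2 by rewrite -mulrA mulr_natl.
by rewrite !mulr2n expr2; apply: eqmD; apply: eqmM.
Qed.

Lemma limit_dissection (e : nat) (A B K1 K2 K3 K4 H1 H2 : pser int)
    (u t : pser int) (q := X ^+ e) : (0 < e)%N -> u ^+ 2 * t = q -> GRing.lreg u ->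
  (forall N L, (N <= L)%N -> eqm N (poch q u L) A) ->
  (forall N L, (N <= L)%N -> eqm N (poch q (u * t) L) B) ->
  (forall N L, (N <= L)%N -> eqm N (poch (q ^+ 4) (- q) L) H1) ->
  (forall N L, (N <= L)%N -> eqm N (poch (q ^+ 4) (- q ^+ 3) L) H2) ->
  (forall N L, (N <= L)%N -> eqm N (poch (q ^+ 4) (- (q * u ^+ 2)) L) K1) ->
  (forall N L, (N <= L)%N -> eqm N (poch (q ^+ 4) (- (q ^+ 2 * t)) L) K2) ->
  (forall N L, (N <= L)%N -> eqm N (poch (q ^+ 4) (- (q ^+ 3 * u ^+ 2)) L) K3) ->
  (forall N L, (N <= L)%N -> eqm N (poch (q ^+ 4) (- t) L) K4) ->
  A * B * (H1 * H2) = (K1 * K2 - u * (K3 * K4)) * Q (-1) e e ^+ 2.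
Proof.
move=> e_gt0 uut ureg hA hB h1 h2 k1 k2 k3 k4; apply: pser_mulr2n_inj.
apply: eqm_eq => N.
have key := @theta_dissection int e e_gt0 u t N uut ureg.
have leN1 : (N <= N.+1)%N := leqnSn N; have leN2 : (N <= N.+2)%N := leqW leN1.
have leND : (N < 2 * N.+1 + 2)%N by lia.
refine (eqm_trans _ (eqm_trans key _)).
  rewrite !mulr2n; apply: eqmD; apply: eqm_sym; apply: eqmM;
    by [apply: eqmM; [apply: hA (ltnW leND) | apply: hB (ltnW leND)]
      | apply: eqmM; [apply: h1 leN2 | apply: h2 leN1]].
rewrite -mulrnAr; apply: eqmM; last exact: theta_norm.
apply: eqmB; first by apply: eqmM; [apply: k1 leN2 | apply: k2 leN1].
by apply: eqmMl; apply: eqmM; [apply: k3 leN1 | apply: k4 leN2].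
Qed.

Lemma X_pow_mul a b c : (a * b = c)%N -> X ^+ a ^+ b = X ^+ c.
Proof. by move=> <-; rewrite exprM. Qed.
Lemma X_pow_add a b c : (a + b = c)%N -> X ^+ a * X ^+ b = X ^+ c.
Proof. by move=> <-; rewrite exprD. Qed.

Lemma theta_dissection_4 :
  Q 1 1 4 * Q 1 3 4 * (Q (-1) 4 16 * Q (-1) 12 16) =
  (Q (-1) 6 16 * Q (-1) 10 16 - X * (Q (-1) 14 16 * Q (-1) 2 16)) * Q (-1) 4 4 ^+ 2.
Proof.
have Xreg : GRing.lreg X by have := @qXn_lreg int 1; rewrite expr1.
have XX2 : X * X ^+ 2 = X ^+ 3 by rewrite -exprS.
have X1 : X ^+ 1 = X := expr1 X.
have q16 := @X_pow_mul 4 4 16 erefl; have q8 := @X_pow_mul 4 2 8 erefl.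
have q12 := @X_pow_mul 4 3 12 erefl.
apply: (@limit_dissection 4 _ _ _ _ _ _ _ _ X (X ^+ 2)) => //.
- exact: (@X_pow_add 2 2 4).
- by move=> N L leNL; rewrite -[in poch _ X _]X1; apply: (@eqm_poch_inf 1 4).
- by move=> N L leNL; rewrite XX2; apply: (@eqm_poch_inf 3 4).
- by move=> N L leNL; rewrite q16; apply: (@eqm_poch_infN 4 16).
- by move=> N L leNL; rewrite q16 q12; apply: (@eqm_poch_infN 12 16).
- by move=> N L leNL; rewrite q16 (@X_pow_add 4 2 6) //; apply: (@eqm_poch_infN 6 16).
- by move=> N L leNL; rewrite q16 q8 (@X_pow_add 8 2 10) //; apply: (@eqm_poch_infN 10 16).
- by move=> N L leNL; rewrite q16 q12 (@X_pow_add 12 2 14) //; apply: (@eqm_poch_infN 14 16).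
- by move=> N L leNL; rewrite q16; apply: (@eqm_poch_infN 2 16).
Qed.

(** The dissections at u = q and u = -q over base q^2 are added, which cancels the part odd in u.
    With phi(q) the sum of q^(n^2) over all integers n, this amounts to phi(q) + phi(-q) = 2
    phi(q^4). *)
Lemma theta_dissection_2 :
  (Q 1 1 2 ^+ 2 + Q (-1) 1 2 ^+ 2) * (Q (-1) 2 8 * Q (-1) 6 8) =
  Q (-1) 4 8 ^+ 2 * Q (-1) 2 2 ^+ 2 *+ 2.
Proof.
have Xreg : GRing.lreg X by have := @qXn_lreg int 1; rewrite expr1.
have NXreg : GRing.lreg (- X) by move=> f g /= /eqP; rewrite !mulNr eqr_opp => /eqP /Xreg.
have X1 : X ^+ 1 = X := expr1 X.
have X0 : X ^+ 0 = 1 := expr0 X.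
have q8 := @X_pow_mul 2 4 8 erefl; have q4 := @X_pow_mul 2 2 4 erefl.
have q6 := @X_pow_mul 2 3 6 erefl.
have dis c u : u = c%:~R * X -> GRing.lreg u -> u ^+ 2 = X ^+ 2 ->
  Q c 1 2 * Q c 1 2 * (Q (-1) 2 8 * Q (-1) 6 8) =
  (Q (-1) 4 8 * Q (-1) 4 8 - u * (Q (-1) 8 8 * Q (-1) 0 8)) * Q (-1) 2 2 ^+ 2.
  move=> uE ureg u2.
  have hc N L : (N <= L)%N -> eqm N (poch (X ^+ 2) u L) (Q c 1 2).
    move=> leNL; rewrite uE -[in _ * X]X1; apply: eqm_sym.
    exact: (@eqm_qpoch_inf c 1 2 N L isT leNL).
  apply: (@limit_dissection 2 _ _ _ _ _ _ _ _ u 1) => //; rewrite ?mulr1 ?u2 //.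
  - by move=> N L leNL; rewrite q8; apply: (@eqm_poch_infN 2 8).
  - by move=> N L leNL; rewrite q8 q6; apply: (@eqm_poch_infN 6 8).
  - by move=> N L leNL; rewrite q8 (@X_pow_add 2 2 4) //; apply: (@eqm_poch_infN 4 8).
  - by move=> N L leNL; rewrite q8 q4; apply: (@eqm_poch_infN 4 8).
  - by move=> N L leNL; rewrite q8 q6 (@X_pow_add 6 2 8) //; apply: (@eqm_poch_infN 8 8).
  - by move=> N L leNL; rewrite q8 -X0; apply: (@eqm_poch_infN 0 8).
have d1 := dis 1 X (esym (mul1r X)) Xreg erefl.
have d2 := dis (-1) (- X) _ NXreg (sqrrN X); rewrite mulrNz mulN1r in d2; have {}d2 := d2 erefl.
rewrite !expr2 mulrDl d1 d2; ring.
Qed.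

Lemma euler_odd_distinct : Q (-1) 2 2 * (Q 1 1 2 * Q (-1) 1 2) = 1.
Proof.
have e1 := @qpoch_inf_opp 1 2 isT; have e2 := @qpoch_inf_opp 2 2 isT.
have e3 := @qpoch_inf_split2 1 2 2 isT.
apply: (@qpoch_inf_lreg 1 4 4 isT); rewrite /= mulr1 -[RHS]e2.
rewrite [in RHS](e3 : Q 1 2 2 = Q 1 2 4 * Q 1 4 4) (e1 : _ = Q 1 2 4).
ring.
Qed.

(** This is j(q;q^4) = j(-q^6;q^16) - q j(-q^2;q^16): the constant in [theta_dissection_4] is
    evaluated by repeated use of (x;q)_oo (-x;q)_oo = (x^2;q^2)_oo. *)
Lemma Jam_1_4 : (Q (-1) 6 16 * Q (-1) 10 16 - X * (Q (-1) 14 16 * Q (-1) 2 16)) * Q 1 16 16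
  = Q 1 1 2 * Q 1 4 4.
Proof.
have e1 := @qpoch_inf_split2 1 1 2 isT; have e2 := @qpoch_inf_split2 (-1) 4 8 isT.
have e3 := @qpoch_inf_split2 (-1) 4 4 isT; have e4 := @qpoch_inf_opp 4 4 isT.
have e5 := @qpoch_inf_opp 8 8 isT; have e6 := theta_dissection_4.
rewrite -(e1 : Q 1 1 2 = Q 1 1 4 * Q 1 3 4) in e6.
rewrite -(e2 : Q (-1) 4 8 = Q (-1) 4 16 * Q (-1) 12 16) in e6.
have {}e3 : Q (-1) 4 4 = Q (-1) 4 8 * Q (-1) 8 8 := e3.
have {}e4 : Q 1 4 4 * Q (-1) 4 4 = Q 1 8 8 := e4.
have {}e5 : Q 1 8 8 * Q (-1) 8 8 = Q 1 16 16 := e5.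
apply: (@qpoch_inf_lreg (-1) 4 8 isT) => /=; move: e6 e3 e4 e5.
move: (_ - X * _) (Q 1 1 2) (Q 1 4 4) (Q 1 16 16) (Q 1 8 8) (Q (-1) 4 4) (Q (-1) 8 8) (Q (-1) 4
    8).
move=> k a E4 E16 E8 n4 n8 h e6 e3 e4 e5.
have -> : h * (a * E4) = a * h * E4 by ring.
rewrite e6 -e5 -e4.
by have -> : k * n4 ^+ 2 * E4 = k * n4 * E4 * (h * n8) by [rewrite -e3; ring]; ring.
Qed.

(** The difference is J_{2,4} j(q;q^4) / J_4, by [Jam_1_4]. *)
Lemma theta_quotients :
  (fps_div (fps_mul (Jam 2 4) (Jbar 6 16)) (Jm 4) : pser int)
    - X * (fps_div (fps_mul (Jam 2 4) (Jbar 2 16)) (Jm 4) : pser int) =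
  Q 1 1 2 ^+ 3 * Q (-1) 1 2 ^+ 2 * Q 1 4 4.
Proof.
have J4E : (Jm 4 : pser int) = Q 1 4 4.
  by have := @qpoch_inf_split3 1 4 4 isT; rewrite -mulrA => e; apply: esym.
have J40 : Jm 4 0%N = 1 by rewrite J4E qpoch_inf_coef0.
have J4u : Q 1 4 4 \is a GRing.unit by rewrite ps_unitE qpoch_inf_coef0.
have J24E : (Jam 2 4 : pser int) = Q 1 2 4 * (Q 1 2 4 * Q 1 4 4) by [].
have J6E : (Jbar 6 16 : pser int) = Q (-1) 6 16 * (Q (-1) 10 16 * Q 1 16 16) by [].
have J2E : (Jbar 2 16 : pser int) = Q (-1) 2 16 * (Q (-1) 14 16 * Q 1 16 16) by [].
have e1 : Q 1 1 2 * Q (-1) 1 2 = Q 1 2 4 := @qpoch_inf_opp 1 2 isT.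
have e2 := Jam_1_4.
apply: (mulrI J4u); rewrite /= /fps_div !fps_mulE !(fps_invE J40).
move: J24E J6E J2E; move: (Jam 2 4 : pser int) (Jbar 6 16 : pser int) (Jbar 2 16 : pser int).
move=> j24 j6 j2 J24E J6E J2E; rewrite J4E.
have -> : Q 1 4 4 * (j24 * j6 / Q 1 4 4 - X * (j24 * j2 / Q 1 4 4)) =
   j24 * (j6 - X * j2) * (Q 1 4 4 / Q 1 4 4) by ring.
rewrite mulrV // mulr1 J24E J6E J2E -e1.
move: e2; move: (Q 1 1 2) (Q (-1) 1 2) (Q 1 4 4) (Q (-1) 6 16) (Q (-1) 10 16).
move: (Q (-1) 14 16) (Q (-1) 2 16) (Q 1 16 16) => w1 w2 E16 a b E4 w3 w4 e2.
have -> : w3 * (w4 * E16) - X * (w2 * (w1 * E16)) = (w3 * w4 - X * (w1 * w2)) * E16 by ring.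
by rewrite e2; ring.
Qed.

(** On the left, the theta part of the rank series and the theta quotients of the statement. Their
    sum contains the factor a^2 + b^2 with a = (q;q^2)_oo and b = (-q;q^2)_oo, which
    [theta_dissection_2] evaluates; the result is the product in [gsum_relation]. *)
Lemma gsum_theta_identity :
  X * (Q 1 1 2 * Q (-1) 1 2 ^+ 4 * Q 1 4 4 + Q 1 1 2 ^+ 3 * Q (-1) 1 2 ^+ 2 * Q 1 4 4) =
  (X * (gsum 1 1 4 : pser int) - (gsum (-1) 6 16 : pser int) + 1
     + X * (gsum (-1) 2 16 : pser int) - X) *+ 2.
Proof.
have e1 : Q 1 1 2 = Q 1 1 4 * Q 1 3 4 := @qpoch_inf_split2 1 1 2 isT.
have e2 : Q (-1) 2 4 = Q (-1) 2 8 * Q (-1) 6 8 := @qpoch_inf_split2 (-1) 2 4 isT.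
have e3 : Q (-1) 2 8 = Q (-1) 2 16 * Q (-1) 10 16 := @qpoch_inf_split2 (-1) 2 8 isT.
have e4 : Q (-1) 6 8 = Q (-1) 6 16 * Q (-1) 14 16 := @qpoch_inf_split2 (-1) 6 8 isT.
have e5 : Q (-1) 4 8 = Q (-1) 4 16 * Q (-1) 12 16 := @qpoch_inf_split2 (-1) 4 8 isT.
have e6 := gsum_relation; have e7 := theta_dissection_2; have e8 := euler_odd_distinct.
rewrite -e5 -e1 in e6; rewrite -e2 in e7.
have e9 : Q (-1) 6 16 * Q (-1) 10 16 * (Q (-1) 14 16 * Q (-1) 2 16) = Q (-1) 2 4.
  rewrite e2 e3 e4; move: (Q _ 6 16) (Q _ 10 16) (Q _ 14 16) (Q _ 2 16) => p1 p2 p3 p4; ring.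
rewrite -[_ * (Q (-1) 14 16 * _)]mulrA e9 in e6.
have r1 := @qpoch_inf_lreg 1 1 2 isT; have r2 := @qpoch_inf_lreg (-1) 2 4 isT.
apply: r1; apply: r2 => /=; move: e6 e7 e8.
move: (X * _ - _ + 1 + _ - X) (Q (-1) 2 4) (Q 1 1 2) (Q (-1) 1 2) (Q (-1) 2 2) (Q 1 4 4) (Q
    (-1) 4 8).
move=> W f a b e E4 h e6 e7 e8.
have -> : f * (a * (W *+ 2)) = (a * f * W) *+ 2 by ring.
rewrite e6.
have -> : f * (a * (X * (a * b ^+ 4 * E4 + a ^+ 3 * b ^+ 2 * E4))) =
  X * (a * b) ^+ 2 * E4 * ((a ^+ 2 + b ^+ 2) * f) by ring.
rewrite e7.
have -> : X * (a * b) ^+ 2 * E4 * (h ^+ 2 * e ^+ 2 *+ 2) =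
    X * E4 * h ^+ 2 * (e * (a * b)) ^+ 2 *+ 2 by ring.
by rewrite e8; ring.
Qed.

End ThetaIdentities.

(** * The rank generating function *)

Section RankSeries.
Variable R : comUnitRingType.
Variables z zi : R.
Hypothesis zzi : z * zi = 1.
Local Notation q := (qX R).
Let cz : pser R := pconst z.
Let czi : pser R := pconst zi.

Let czzi : cz * czi = 1.
Proof.
apply/funext => n; rewrite psM big_ord_recl big1 ?addr0 ?subn0 => [|i _].
  by rewrite ps1 /cz /czi /pconst /= ; case: n => [|n] /=; rewrite ?zzi ?mulr0.
by rewrite /cz /pconst /= mul0r.
Qed.

Lemma pconstM (c : R) f n : (pconst c * f) n = c * f n.
Proof.
by rewrite psM big_ord_recl subn0 big1 ?addr0 // => i _; rewrite /pconst mul0r.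
Qed.

Lemma pconstX (c : R) n : pconst c ^+ n = pconst (c ^+ n).
Proof.
elim: n => [|n IH] //; rewrite exprS IH; apply/funext => m.
by rewrite pconstM /pconst exprS; case: eqP; rewrite ?mulr0.
Qed.

Definition rank_series : pser R := fun n =>
  \sum_(f : ptype n | is_partition f) z ^+ largest_part f * zi ^+ num_parts f.

Let b m := poch q (q * czi) m.
Let a m := poch q (q * cz) m.

Let b_unit m : b m \is a GRing.unit.
Proof. by apply: poch_unit; rewrite psM0 mul0r. Qed.
Let a_unit m : a m \is a GRing.unit.
Proof. by apply: poch_unit; rewrite psM0 mul0r. Qed.

Let geom_inv N (y : pser R) : eqm N (y ^+ N) 0 -> 1 - y \is a GRing.unit ->
  eqm N (\sum_(k < N) y ^+ k) (1 - y)^-1.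
Proof.
move=> yN uy; rewrite -[X in eqm N X](mulKr uy).
have -> : (1 - y) * (\sum_(k < N) y ^+ k) = 1 - y ^+ N.
  by rewrite -opprB mulNr -subrX1 opprB.
rewrite -[X in eqm N _ X]mulr1; apply: eqmMl.
by rewrite -[X in eqm N _ X]subr0; apply: eqmB.
Qed.

Let largest_leq n (f : ptype n) m :
  (largest_part f <= m)%N = (f \in family (fun i : 'I_n => [pred k : 'I_n.+1 | (i < m)%N || (k
      == ord0)])).
Proof.
apply/bigmax_leqP/familyP => H i.
  by rewrite inE; case: (eqVneq (f i) ord0) => [_|fi]; rewrite ?orbT ?orbF //; apply: H.
by move=> fi; have := H i; rewrite inE -val_eqE /= (negbTE fi) orbF.
Qed.

(** Expanding each 1/(1 - z^(-1) q^(i+1)) geometrically, a choice of exponents is a multiplicity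
    function; [Qd] leaves only exponent 0 for parts larger than m. *)
Let bounded_parts n m : (m <= n)%N ->
  \sum_(f : ptype n | is_partition f && (largest_part f <= m)%N) zi ^+ num_parts f =
  (b m)^-1 n.
Proof.
move=> lemn; pose y i : pser R := czi * q ^+ i.+1.
pose Qd (i : 'I_n) := [pred k : 'I_n.+1 | (i < m)%N || (k == ord0)].
have yE (i : nat) : q * czi * q ^+ i = y i by rewrite /y exprS; ring.
have bE : b m = \prod_(i < n | (i < m)%N) (1 - y i).
  by rewrite /b /poch (big_ord_widen n (fun i => 1 - q * czi * q ^+ i) lemn);
      apply: eq_bigr => i _; rewrite yE.
have prodE : eqm n.+1 (\prod_(i < n) \sum_(k < n.+1 | Qd i k) y i ^+ k) (b m)^-1.
  have uy i : 1 - y i \is a GRing.unit.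
    by rewrite ps_unitE psD psN /y psM0 qXn /= mulr0 subr0 unitr1.
  have -> : (b m)^-1 = \prod_(i < n | (i < m)%N) (1 - y i)^-1.
    by rewrite bE prodrV.
  rewrite [X in eqm _ _ X]big_mkcond /=.
  elim/big_rec2: _ => [|i u v _ IH]; first by [].
  apply: eqmM IH; case: ifP => im.
    rewrite (eq_bigl xpredT) //.
    apply: geom_inv => //; rewrite exprMn -exprM mulrC; apply: eqmXn; nia.
  by rewrite (big_pred1 ord0) ?expr0.
have termE (f : ptype n) : (\prod_(i < n) y i ^+ f i) n =
    if is_partition f then zi ^+ num_parts f else 0.
  have -> : \prod_(i < n) y i ^+ f i = q ^+ (\sum_(i < n) i.+1 * f i) * czi ^+ num_parts f.
    rewrite /num_parts -!prodrXr -big_split /=; apply: eq_bigr => i _.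
    by rewrite /y exprMn exprM mulrC.
  rewrite pconstX qXnM /is_partition; set S := (\sum_(i < n) _)%N.
  case: (ltngtP n S) => [//|lt|eS]; last by rewrite -eS subnn.
  by rewrite /pconst subn_eq0 leqNgt lt.
rewrite -(prodE n (leqnn _)) bigA_distr_big_dep ps_sum /=.
rewrite (eq_bigr _ (fun f _ => termE f)) -big_mkcondr /=.
by apply: eq_bigl => f; rewrite andbC largest_leq.
Qed.

(* Abel summation: rewrites [z^(largest part)] through the bounds on the largest part. *)
Let sum_levels (u : nat -> R) l n : (l <= n)%N ->
  u l = u n - \sum_(m < n | (l <= m)%N) (u m.+1 - u m).
Proof.
elim: n => [|n IH]; first by rewrite leqn0 => /eqP ->; rewrite big_ord0 subr0.
rewrite leq_eqVlt => /predU1P[->|]; last rewrite ltnS => leln.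
  by rewrite big1 ?subr0 // => i; rewrite leqNgt ltn_ord.
rewrite big_mkcond big_ord_recr /= leln -big_mkcond /= {1}(IH leln).
move: (\sum_(_ < _ | _) _) => S; ring.
Qed.

(** Partitions are sorted by largest part: those with largest part m+1 are counted by 1/b(m+1) -
    1/b(m) = z^(-1) q^(m+1) / b(m+1). *)
Let rank_levels n : rank_series n =
  (1 + \sum_(m < n) cz ^+ m * q ^+ m.+1 / b m.+1) n.
Proof.
have Binv m : (b m.+1)^-1 - (b m)^-1 = czi * q ^+ m.+1 / b m.+1.
  have ub := b_unit m; have ubS := b_unit m.+1.
  have bS : b m.+1 = b m * (1 - czi * q ^+ m.+1).
    by rewrite /b pochS exprS; ring.
  have {1}-> : (b m)^-1 = (1 - czi * q ^+ m.+1) / b m.+1.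
    apply: (mulrI ub); rewrite mulrV // mulrA -bS mulrV //.
  by rewrite -{1}[(b m.+1)^-1]mul1r -mulrBl; congr (_ / _); ring.
have step m : cz ^+ m.+1 * ((b m.+1)^-1 - (b m)^-1) = cz ^+ m * q ^+ m.+1 / b m.+1.
  by rewrite Binv exprSr !mulrA -[cz ^+ m * cz * czi]mulrA czzi mulr1.
have leln (f : ptype n) : (largest_part f <= n)%N.
  by apply/bigmax_leqP => i _; apply: ltn_ord.
transitivity ((cz ^+ n / b n - \sum_(m < n) (cz ^+ m.+1 - cz ^+ m) / b m) n).
  rewrite psD psN ps_sum /rank_series.
  rewrite (eq_bigr (fun f => z ^+ n * zi ^+ num_parts f - \sum_(m < n | (largest_part f <= m)%N)
     (z ^+ m.+1 - z ^+ m) * zi ^+ num_parts f)); last first.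
    by move=> f _; rewrite (sum_levels (fun k => z ^+ k) (leln f)) mulrBl mulr_suml.
  rewrite sumrB; congr (_ - _).
    rewrite -mulr_sumr pconstX pconstM -(bounded_parts (leqnn n)); congr (_ * _);
        apply: eq_bigl => f.
    by rewrite leln andbT.
  rewrite (exchange_big_dep xpredT) //=; apply: eq_bigr => m _.
  rewrite -mulr_sumr (bounded_parts (ltnW (ltn_ord m))) !pconstX.
  have -> : pconst (z ^+ m.+1) - pconst (z ^+ m) = pconst (z ^+ m.+1 - z ^+ m) :> pser R.
    by apply/funext => k; rewrite psD psN /pconst; case: eqP; rewrite ?subr0.
  by rewrite pconstM.
suff H m : cz ^+ m / b m - \sum_(j < m) (cz ^+ j.+1 - cz ^+ j) / b j =
    1 + \sum_(j < m) cz ^+ j * q ^+ j.+1 / b j.+1 by rewrite H.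
elim: m => [|m IH].
  by rewrite !big_ord0 /b /poch big_ord0 expr0 subr0 addr0 divr1.
rewrite !big_ord_recr /= -step addrA -IH; ring.
Qed.

(* Fine's functional equation, whose iteration turns the sum over the largest part into the
   sum over Durfee squares. *)
Let V k M := \sum_(j < M) cz ^+ j * q ^+ (k * j) / b (k + j).

Let V_rec k M : (1 - cz * q ^+ k) * V k M.+1 =
  (b k)^-1 + q ^+ (2 * k).+1 * V k.+1 M - cz ^+ M.+1 * q ^+ (k * M.+1) / b (k + M).
Proof.
rewrite /V; elim: M => [|M IH].
  by rewrite big_ord_recr !big_ord0 /= muln0 muln1 addn0 !expr0 expr1; ring.
have ub := b_unit (k + M); have ubS := b_unit (k + M).+1.
have bS : b (k + M).+1 = b (k + M) * (1 - czi * q ^+ (k + M).+1).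
  by rewrite /b pochS exprS; ring.
have bV : (b (k + M))^-1 = (1 - czi * q ^+ (k + M).+1) / b (k + M).+1.
  by apply: (mulrI ub); rewrite mulrV // mulrA -bS mulrV.
rewrite big_ord_recr /= mulrDr IH [in RHS]big_ord_recr /= bV !addSn !addnS.
have -> : cz ^+ M.+1 * q ^+ (k * M.+1) * ((1 - czi * q ^+ (k + M).+1) / b (k + M).+1) =
   (cz ^+ M.+1 * q ^+ (k * M.+1) - (cz * czi) * cz ^+ M * (q ^+ (k * M.+1) * q ^+ (k +
       M).+1)) / b (k + M).+1.
  by rewrite [cz ^+ M.+1]exprS; ring.
rewrite czzi mul1r.
have -> : q ^+ (k * M.+2) = q ^+ k * q ^+ (k * M.+1) by rewrite -exprD; congr (_ ^+ _); lia.
have -> : q ^+ (k * M.+1) * q ^+ (k + M).+1 = q ^+ (2 * k).+1 * q ^+ (k.+1 * M).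
  by rewrite -!exprD; congr (_ ^+ _); lia.
move: (\sum_(_ < _) _) => S; rewrite [cz ^+ M.+2]exprS; ring.
Qed.

Lemma rank_series_eqm N : eqm N rank_series
  (\sum_(k < N.+1) q ^+ (k ^ 2) / (poch q (q * cz) k * poch q (q * czi) k)).
Proof.
(* After k uses of [V_rec] the first k+1 Durfee terms have split off; at k = N the remaining [V] is
   an empty sum. *)
have stage k : (k <= N)%N -> eqm N (1 + q * V 1 N)
    (\sum_(j < k.+1) q ^+ (j ^ 2) / (a j * b j) + q ^+ (k.+1 ^ 2) / a k * V k.+1 (N - k)).
  elim: k => [|k IH] lek.
    rewrite subn0 big_ord_recl big_ord0 /a /b /poch !big_ord0 !expr0 mulr1 divr1 addr0.
    by rewrite exp1n expr1 divr1.
  apply: (eqm_trans (IH (ltnW lek))); rewrite [in X in eqm _ _ X]big_ord_recr /= -addrA;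
      apply: eqmD => //.
  have -> : (N - k = (N - k.+1).+1)%N by lia.
  have uz : 1 - cz * q ^+ k.+1 \is a GRing.unit.
    by rewrite ps_unitE psD psN psM0 qXn /= mulr0 subr0 unitr1.
  have aS : a k.+1 = a k * (1 - cz * q ^+ k.+1).
    by rewrite /a pochS exprS; congr (_ * (1 - _)); ring.
  rewrite -[V k.+1 _](mulKr uz) V_rec.
  set S := V k.+2 _; set E := cz ^+ _ * _ / _.
  (* The order is at least (k+1)(N-k) = N + k(N-k-1), and k < N. *)
  have E0 : eqm N E 0.
    rewrite /E -mulrA mulrCA; apply: eqmXn; nia.
  have -> : q ^+ (k.+1 ^ 2) / a k * ((1 - cz * q ^+ k.+1)^-1 *
      ((b k.+1)^-1 + q ^+ (2 * k.+1).+1 * S - E)) =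
      q ^+ (k.+1 ^ 2) / (a k.+1 * b k.+1) + q ^+ (k.+2 ^ 2) / a k.+1 * S
      - q ^+ (k.+1 ^ 2) / a k.+1 * E.
    have -> : q ^+ (k.+2 ^ 2) = q ^+ (k.+1 ^ 2) * q ^+ (2 * k.+1).+1.
      by rewrite -exprD; congr (_ ^+ _); lia.
    rewrite [(a _ * b _)^-1]invrM // aS invrM //; ring.
  rewrite -[X in eqm _ _ X]subr0; apply: eqmB => //.
  by rewrite -[0](mulr0 (q ^+ (k.+1 ^ 2) / a k.+1)); apply: eqmMl.
have -> : \sum_(k < N.+1) q ^+ (k ^ 2) / (poch q (q * cz) k * poch q (q * czi) k) =
  \sum_(j < N.+1) q ^+ (j ^ 2) / (a j * b j) + q ^+ (N.+1 ^ 2) / a N * V N.+1 (N - N).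
  by rewrite subnn /V big_ord0 mulr0 addr0.
apply: eqm_trans (stage N (leqnn N)).
move=> n ltnN; rewrite rank_levels.
have -> : 1 + q * V 1 N = 1 + \sum_(m < N) cz ^+ m * q ^+ m.+1 / b m.+1.
  rewrite /V mulr_sumr; congr (_ + _); apply: eq_bigr => m _.
  by rewrite mul1n add1n exprS; ring.
rewrite !psD !ps_sum; congr (_ + _).
rewrite -(subnKC (ltnW ltnN)) big_split_ord /= [X in _ = _ + X]big1 ?addr0 // => m _.
by rewrite mulrAC mulrC qXnM ltnS leq_addr.
Qed.

End RankSeries.

(** * Ranks modulo 4 *)

Lemma rmorph_poch (C C' : comNzRingType) (h : {rmorphism C -> C'}) q x n :
  h (poch q x n) = poch (h q) (h x) n.
Proof.
rewrite rmorph_prod; apply: eq_bigr => i _.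
by rewrite rmorphB rmorphM rmorphXn rmorph1.
Qed.

Lemma rmorph_gser (C C' : comUnitRingType) (h : {rmorphism C -> C'}) q x y n :
  (forall k, poch q x k * poch q y k \is a GRing.unit) ->
  h (gser q x y n) = gser (h q) (h x) (h y) n.
Proof.
move=> u; rewrite rmorph_sum; apply: eq_bigr => k _.
by rewrite rmorphM rmorphV ?u // rmorphXn rmorphM !rmorph_poch.
Qed.

Section RankAtI.
Notation X := (qX int).
Notation Y := (qX algC).
Notation Q c a m := (qpoch_inf c a m : pser int).
Notation iota := (psmap (intmul (1 : algC))).
Let u : pser algC := pconst 'i.
Let v : pser algC := pconst (- 'i).

Let ii : 'i * - 'i = 1 :> algC.
Proof. by rewrite mulrN -expr2 sqrCi opprK. Qed.

Let vE : v = - u.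
Proof. by apply/funext => n; rewrite psN /u /v /pconst; case: eqP; rewrite ?oppr0. Qed.

Let u2 : u ^+ 2 = -1.
Proof.
rewrite /u pconstX sqrCi; apply/funext => n; rewrite psN ps1 /pconst.
by case: eqP; rewrite ?oppr0.
Qed.

Let u_lreg : GRing.lreg u.
Proof.
by move=> f g /= e; rewrite -[f]mul1r -[g]mul1r -[1]opprK -u2 expr2 !mulNr -!mulrA e.
Qed.

(** The first factor 1 - i is not a unit among the Gaussian integers; over [algC] it is. *)
Let poch_u_unit k : poch Y u k \is a GRing.unit.
Proof.
case: k => [|k]; first by rewrite /poch big_ord0 unitr1.
rewrite poch_recl unitrM (poch_unit _ _ _) ?psM0 ?mul0r // andbT.
rewrite ps_unitE psD psN ps1 /u /pconst /= unitfE subr_eq0 eq_sym.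
by apply: contraNneq (nonRealCi algC) => ->; apply: real1.
Qed.

(** The factor 1 - U, taken from (U;q)_n, merges the two terms in [G]: (1 - U)(1 + U) = 2, and the
    imaginary unit disappears from them. *)
Let rank_combine (p1 p2 pa pb U g G Sg E x : pser algC) N :
  U ^+ 2 = -1 -> (1 - U) * (1 + U * g) = Sg + E -> eqm N E 0 ->
  eqm N ((1 - U) * p1 * p2 * (pa * pb) * (pb * pa) * (1 + U * g + x * U * G - - x * G))
        ((Sg + 2 * (x * G)) * (p1 * p2) * (pa * pb) ^+ 2).
Proof.
move=> U2 e E0.
have -> : (1 - U) * p1 * p2 * (pa * pb) * (pb * pa) * (1 + U * g + x * U * G - - x * G) =
   ((1 - U) * (1 + U * g) + (1 - U ^+ 2) * (x * G)) * (p1 * p2) * (pa * pb) ^+ 2 by ring.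
rewrite e U2 opprK; apply: eqmMr; apply: eqmMr; apply: eqmD; last exact: eqm_eqr.
exact: eqm_add0.
Qed.

(* The elliptic identity at u = i, multiplied by 1 - i. *)
Lemma rank_series_theta :
  (rank_series 'i (- 'i : algC) + iota (2 * ((gsum 1 1 4 : pser int) - 1))) *
     iota (Q (-1) 2 2 * Q 1 1 2 ^+ 2) = iota (Q 1 1 1 * Q (-1) 1 2 ^+ 2).
Proof.
apply: eqm_eq => N.
have x1 k : (0 < k)%N -> (Y ^+ k : pser algC) 0%N = 0 by move=> ?; rewrite qXn ltn_eqF.
have e1 : - (Y * u ^+ 2) = Y by rewrite u2; ring.
have e2 : - (Y ^+ 2 * - Y) = Y ^+ 3 by ring.
have e3 : - (Y ^+ 3 * u ^+ 2) = Y ^+ 3 by rewrite u2; ring.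
have e4 : u * - Y = Y * v by rewrite vE; ring.
have uut : u ^+ 2 * - Y = Y by rewrite u2; ring.
have key := @elliptic_identity algC 1 isT u (- Y) N N.
rewrite (expr1 Y) /thetaH /ellipH e1 e2 e3 opprK e4 in key.
have pu1 k : poch Y (Y * v) k \is a GRing.unit.
  by apply: poch_unit; rewrite psM0 mul0r.
have pu2 k : poch (Y ^+ 4) Y k \is a GRing.unit by apply: poch_unit.
have pu3 k : poch (Y ^+ 4) (Y ^+ 3) k \is a GRing.unit by apply: poch_unit; apply: x1.
have {}key := key uut u_lreg (leqnn N) poch_u_unit pu1 pu2 pu3 pu3 pu2.
have {}key : eqm N ((1 - u) * poch Y (Y * u) N * poch Y (Y * v) N.+1 *
    (poch (Y ^+ 4) Y N.+2 * poch (Y ^+ 4) (Y ^+ 3) N.+1) *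
    (poch (Y ^+ 4) (Y ^+ 3) N.+1 * poch (Y ^+ 4) Y N.+2) *
    (1 + u * gser Y u (Y * v) N.+1 + Y * u * gser (Y ^+ 4) Y (Y ^+ 3) N.+1 -
     - Y * gser (Y ^+ 4) Y (Y ^+ 3) N.+1))
    (poch Y Y N.+1 * (poch (Y ^+ 4) (- Y) N.+2 * poch (Y ^+ 4) (- Y ^+ 3) N.+1) ^+ 2).
  by move: key; rewrite [poch Y u _]poch_recl [gser _ (Y ^+ 3) _ _]gserC.
have rk := @rank_series_eqm _ _ _ ii N; rewrite -/u -/v in rk.
set Sg := \sum_(k < N.+1) _ in rk.
pose E := (1 - u) * (Y ^+ (N.+1 ^ 2) / (poch Y u N.+1 * poch Y (Y * v) N.+1)).
have uvY : u * (Y * v) = Y by rewrite vE mulrN mulrN mulrCA -expr2 u2; ring.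
have SgE : (1 - u) * (1 + u * gser Y u (Y * v) N.+1) = Sg + E.
  have unitP k : (k <= N.+1)%N -> poch Y u k * poch Y (Y * v) k \is a GRing.unit.
    by move=> _; rewrite unitrM poch_u_unit pu1.
  have e := rank_gser uvY unitP.
  have -> : 1 + u * gser Y u (Y * v) N.+1 =
     \sum_(k < N.+1) Y ^+ (k ^ 2) / (poch Y u k.+1 * poch Y (Y * v) k) +
     Y ^+ (N.+1 ^ 2) / (poch Y u N.+1 * poch Y (Y * v) N.+1) by rewrite e subrK.
  rewrite mulrDr; congr (_ + _); rewrite mulr_sumr; apply: eq_bigr => k _.
  have u1u : 1 - u \is a GRing.unit.
    by have := poch_u_unit 1; rewrite /poch big_ord1 expr0 mulr1.
  rewrite poch_recl -[(1 - u) * _ * _]mulrA mulrCA; congr (_ * _).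
  rewrite [in LHS]invrM // ?unitrM ?pu1 ?andbT; last by apply: poch_unit; rewrite psM0 mul0r.
  by rewrite mulrCA mulrV // mulr1.
have E0 : eqm N E 0.
  by rewrite /E mulrCA; apply: eqmXn; nia.
have {SgE} := rank_combine (poch Y (Y * u) N) (poch Y (Y * v) N.+1) (poch (Y ^+ 4) Y N.+2)
   (poch (Y ^+ 4) (Y ^+ 3) N.+1) (gser (Y ^+ 4) Y (Y ^+ 3) N.+1) Y u2 SgE E0.
move=> /eqm_sym /eqm_trans /(_ key) {}key.
have h1 a m L : (0 < m)%N -> (N <= L)%N -> eqm N (poch (Y ^+ m) (Y ^+ a) L) (iota (Q 1 a m)).
  move=> m_gt0 leNL; have := eqm_psmap (intmul (1 : algC)) (@eqm_poch_inf a m N L m_gt0 leNL).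
  by rewrite rmorph_poch !rmorphXn /= psmap_qX.
have hN a m L : (0 < m)%N -> (N <= L)%N -> eqm N (poch (Y ^+ m) (- Y ^+ a) L) (iota (Q (-1) a m)).
  move=> m_gt0 leNL; have := eqm_psmap (intmul (1 : algC)) (@eqm_poch_infN a m N L m_gt0 leNL).
  by rewrite rmorph_poch rmorphN !rmorphXn /= psmap_qX.
have Y1 : Y ^+ 1 = Y := expr1 Y; have X1 : X ^+ 1 = X := expr1 X.
have leN1 : (N <= N.+1)%N := leqnSn N; have leN2 : (N <= N.+2)%N := leqW leN1.
have hS : eqm N (iota (gsum 1 1 4 : pser int)) (1 + Y * gser (Y ^+ 4) Y (Y ^+ 3) N.+1).
  have := eqm_psmap (intmul (1 : algC)) (@gsum_eqm 1 1 4 N N.+1 erefl isT isT leN1).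
  rewrite !mul1r X1 rmorphD rmorphM rmorph1 /= rmorph_gser ?rmorphXn /= ?psmap_qX //.
  have X3 : (X ^+ (4 - 1) : pser int) 0%N = 0 by rewrite qXn.
  move=> k; rewrite unitrM; apply/andP; split; last exact: poch_unit X3.
  exact: (poch_unit _ _ (erefl : X 0%N = 0)).
have hp : eqm N (poch Y (Y * u) N * poch Y (Y * v) N.+1) (iota (Q (-1) 2 2)).
  have hu : eqm N (poch Y (Y * u) N) (poch Y (Y * u) N.+1).
    by have := @eqm_poch algC 1 isT N (Y ^+ 1 * u) N N.+1 (leqnn N) leN1; rewrite Y1 => /eqm_sym.
  refine (eqm_trans (eqmMr _ hu) _).
  have -> : Y * v = - (Y * u) by rewrite vE; ring.
  rewrite poch_opp exprMn u2 mulrN1; exact: hN.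
have ha : eqm N (poch (Y ^+ 4) Y N.+2 * poch (Y ^+ 4) (Y ^+ 3) N.+1) (iota (Q 1 1 2)).
  rewrite (@qpoch_inf_split2 1 1 2 isT) rmorphM; apply: eqmM; last exact: h1.
  by have := h1 1 4 N.+2 isT leN2; rewrite Y1.
have hb : eqm N (poch (Y ^+ 4) (- Y) N.+2 * poch (Y ^+ 4) (- Y ^+ 3) N.+1) (iota (Q (-1) 1 2)).
  rewrite (@qpoch_inf_split2 (-1) 1 2 isT) rmorphM; apply: eqmM; last exact: hN.
  by have := hN 1 4 N.+2 isT leN2; rewrite Y1.
have hq : eqm N (poch Y Y N.+1) (iota (Q 1 1 1)).
  by have := h1 1 1 N.+1 isT leN1; rewrite Y1.
have sq (f g : pser algC) : eqm N f g -> eqm N (f ^+ 2) (g ^+ 2)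
    by move=> fg; rewrite !expr2; apply: eqmM.
have rM2 (f g : pser int) : iota (f * g ^+ 2) = iota f * iota g ^+ 2 by rewrite rmorphM rmorphXn.
rewrite !rM2 [iota (2 * _)]rmorphM rmorphB rmorph1 rmorph_nat /=.
refine (eqm_trans _ (eqm_trans key _)); last exact: (eqmM hq (sq _ _ hb)).
rewrite [X in eqm _ X _]mulrA; apply: eqmM; last exact: (sq _ _ (eqm_sym ha)).
apply: eqmM; last exact: eqm_sym hp.
apply: eqmD => //; apply: eqmMl.
have -> : Y * gser (Y ^+ 4) Y (Y ^+ 3) N.+1 = 1 + Y * gser (Y ^+ 4) Y (Y ^+ 3) N.+1 - 1 by ring.
by apply: eqmB.
Qed.

Lemma rank_series_int : rank_series 'i (- 'i : algC) =
  iota (Q 1 1 2 * Q (-1) 1 2 ^+ 4 * Q 1 4 4 - 2 * ((gsum 1 1 4 : pser int) - 1)).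
Proof.
have e1 : Q 1 1 2 * Q (-1) 1 2 = Q 1 2 4 := @qpoch_inf_opp 1 2 isT.
have e2 : Q 1 2 2 = Q 1 2 4 * Q 1 4 4 := @qpoch_inf_split2 1 2 2 isT.
have e3 : Q 1 1 1 = Q 1 1 2 * Q 1 2 2 := @qpoch_inf_split2 1 1 1 isT.
have e4 := euler_odd_distinct; have key := rank_series_theta.
have au : Q 1 1 2 \is a GRing.unit by rewrite ps_unitE qpoch_inf_coef0.
move: e1 e2 e3 e4 key au; move: (Q 1 1 2) (Q (-1) 1 2) (Q 1 2 4) (Q 1 4 4) (Q 1 2 2) (Q 1 1 1).
move: (Q (-1) 2 2) (2 * _) (rank_series _ _) => e S rho a b d4 E4 d2 q1 e1 e2 e3 e4 key au.
(* Euler's identity e a b = 1 replaces the factor e a^2 by a / b. *)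
have eab : e * a ^+ 2 * b = a by rewrite -[RHS]mulr1 -e4; ring.
have key2 : (rho + iota S) * iota a = iota (a * (a * b ^+ 4 * E4)).
  have -> : iota a = iota (e * a ^+ 2) * iota b by rewrite -rmorphM eab.
  rewrite [LHS]mulrA key -rmorphM; congr (iota _).
  by rewrite e3 e2 -e1; ring.
have : rho + iota S = iota (a * b ^+ 4 * E4).
  by apply: (mulrI (rmorph_unit iota au)); rewrite /= mulrC key2 rmorphM.
by move=> eS; rewrite rmorphB /= -eS addrK.
Qed.
End RankAtI.

(** The real part of i^(l-m) runs through 1, 0, -1, 0, so odd ranks drop out. Writing -i = i^3 keeps
    the exponent [l + 3 * m] natural. *)
Lemma Re_iexp (l m : nat) : 'Re ('i ^+ l * (- 'i) ^+ m : algC) =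
  ((l%:Z - m%:Z - 0) %% 4%:Z == 0)%Z%:R - ((l%:Z - m%:Z - 2) %% 4%:Z == 0)%Z%:R.
Proof.
have -> : - 'i = 'i ^+ 3 :> algC by rewrite exprS sqrCi mulrN1.
rewrite -exprM -exprD (divn_eq (l + 3 * m)%N 4) exprD mulnC exprM.
have -> : 'i ^+ 4 = 1 :> algC by rewrite (exprM _ 2 2) sqrCi expr2 mulrNN mulr1.
rewrite expr1n mul1r.
have [k ek] : exists k : int, l%:Z - m%:Z = k * 4 + ((l + 3 * m) %% 4)%N%:Z.
  by exists (((l + 3 * m) %/ 4)%N%:Z - m%:Z); have := divn_eq (l + 3 * m)%N 4; lia.
rewrite subr0 ek -addrA !modzMDl.
have : ((l + 3 * m) %% 4 < 4)%N by rewrite ltn_mod.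
case: ((l + 3 * m) %% 4)%N => [|[|[|[|//]]]] _ /=.
- by rewrite expr0 /= subr0; apply/Creal_ReP; apply: real1.
- by rewrite expr1 Re_i subr0.
- rewrite sqrCi sub0r; apply/Creal_ReP; rewrite realN; apply: real1.
- by rewrite exprS sqrCi mulrN1 raddfN /= Re_i subr0 oppr0.
Qed.

Lemma rank_count n : 'Re (rank_series 'i (- 'i : algC) n) =
  (Nrank 0 4 n)%:R - (Nrank 2 4 n)%:R.
Proof.
rewrite /rank_series raddf_sum /=.
rewrite (eq_bigr _ (fun f _ => Re_iexp (largest_part f) (num_parts f))) sumrB.
have cnt c : \sum_(f : ptype n | is_partition f)
    ((((largest_part f)%:Z - (num_parts f)%:Z - c) %% 4%:Z == 0)%Z%:R : algC) = (Nrank c 4 n)%:R.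
  rewrite /Nrank -sum1_card natr_sum big_mkcond [RHS]big_mkcond /=.
  by apply: eq_bigr => f _; rewrite inE; case: is_partition => //=; case: eqP.
by rewrite !cnt.
Qed.

Theorem theorem1p2 :
  lser_eq
    (lser_of (fun n => (Nrank 0 4 n)%:Z - (Nrank 2 4 n)%:Z))
    (ladd
      (lsub
        (ladd
          (lsub (lconst 2)
                (lmul (lconst 2) (lmul (lqpow 2) (gmock (-1) 2 16))))
          (lmul (lconst 2) (lmul (lqpow 5) (gmock (-1) 6 16))))
        (lser_of (fps_div (fps_mul (Jam 2 4) (Jbar 6 16)) (Jm 4))))
      (lmul (lqpow 1)
            (lser_of (fps_div (fps_mul (Jam 2 4) (Jbar 2 16)) (Jm 4))))).
Proof.
set phi : fps := fun n => _.
pose X : pser int := qX int; pose S1 : pser int := gsum 1 1 4;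
    pose S2 : pser int := gsum (-1) 2 16.
pose S6 : pser int := gsum (-1) 6 16.
have phiE : (phi : pser int) =
    (qpoch_inf 1 1 2 : pser int) * (qpoch_inf (-1) 1 2 : pser int) ^+ 4 *
    (qpoch_inf 1 4 4 : pser int) - 2 * (S1 - 1).
  (* The rank series at i is integral by [rank_series_int], so taking real parts loses nothing. *)
  apply/funext => n; apply/eqP; rewrite -(eqr_int algC); apply/eqP.
  have := rank_count n; rewrite rank_series_int psmapE /=.
  have real_int (k : int) : 'Re (k%:~R : algC) = k%:~R.
    by apply/Creal_ReP; apply: Rreal_int; apply: intr_int.
  by rewrite real_int /phi intrB !natz => ->.
have th := theta_quotients; have gt := gsum_theta_identity.
(* 2 q^5 g(-q^6;q^16) equals 2 q^(-1) (1 - S6); the factor [X] removes this pole. *)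
have XphiE : X * (phi : pser int) = 2 * (X * S2 - S6 + 1) - X * (
    (fps_div (fps_mul (Jam 2 4) (Jbar 6 16)) (Jm 4) : pser int)
    - X * (fps_div (fps_mul (Jam 2 4) (Jbar 2 16)) (Jm 4) : pser int)).
  rewrite th phiE; move: gt; rewrite -/X -/S1 -/S2 -/S6.
  set a := (_ * _ * _ : pser int); set b := (_ ^+ 3 * _ * _ : pser int) => e.
  have -> : X * (a - 2 * (S1 - 1)) = X * (a + b) - X * b - 2 * X * (S1 - 1) by ring.
  by rewrite e; ring.
move=> n; rewrite /ladd /lsub /lmul /lopp /ladd /lser_of /lconst /lqpow /gmock /lmul /lser_of /=.
move: XphiE; set d1 := fps_div (fps_mul (Jam 2 4) (Jbar 6 16)) (Jm 4).
set d2 := fps_div (fps_mul (Jam 2 4) (Jbar 2 16)) (Jm 4) => XphiE.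
rewrite !(fps_mulE, fps_addE, fps_oppE, fps_XE, fps_constE).
rewrite !add0n !addn0; apply: (congr1 (fun f : pser int => f n)).
(* The prefactors q^(-2) and q^(-6) of the two [gmock] terms make up the common denominator q^8; one
   of its powers is used by [XphiE]. *)
have -> : X ^+ (2 + 6) * (phi : pser int) = X ^+ 7 * (X * (phi : pser int)).
  by rewrite mulrA -exprSr.
rewrite XphiE -/X -/S2 -/S6 expr0; clear; clearbody X S2 S6 d1 d2; ring.
Qed.
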